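(* For every fixed integer $n\geq 4$, as $m\to\infty$, \[ s_A(m,n,2) = \begin{cases} O(m^{1-1/(n-1)}) & \text{if } n \equiv 0 \pmod{3};\\ O(m^{1-1/n}) & \text{if } n \equiv 1,2 \pmod{3};\\ O(m^{6/7}) & \text{if } n \in\{8,9\}. \end{cases} \]
   Context: Static set membership in the bit-probe model. The universe is $[m]=\{1,\dots,m\}$. A (classical, adaptive) $t$-probe scheme of length $s$ for sets of size at most $n$ consists of (i) a storage map assigning to every subset $S\subseteq[m]$ with $|S|\le n$ a bit string $b(S)\in\{0,1\}^s$, and (ii) for every $x\in[m]$ a deterministic query procedure that reads at most $t$ bits of the string, where the position of each read may depend on the values of the bits read previously (a decision tree of depth $t$), and outputs a bit; it is required that for every such $S$ and every $x\in[m]$ the output on $b(S)$ equals $1$ iff $x\in S$. $s_A(m,n,t)$ denotes the minimum length $s$ of such a scheme. Asymptotic notation is with $n$ fixed and $m\to\infty$. *)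

(* Defs.v *)
From HB Require Import structures.
From mathcomp Require Import all_boot all_order all_algebra.
From mathcomp Require Import all_classical all_reals all_analysis.

Set Implicit Arguments.
Unset Strict Implicit.
Unset Printing Implicit Defensive.

Import Order.TTheory GRing.Theory Num.Theory.

Inductive dtree (s : nat) : Type :=
| Answer of bool
| Probe of 'I_s & dtree s & dtree s.

Fixpoint depth (s : nat) (q : dtree s) : nat :=
  match q with
  | Answer _ => 0
  | Probe _ q0 q1 => (maxn (depth q0) (depth q1)).+1
  end.

(* The first subtree is taken when the probed bit is 0, the second when it
   is 1. *)
Fixpoint run (s : nat) (q : dtree s) (w : s.-tuple bool) : bool :=
  match q with
  | Answer a => a
  | Probe i q0 q1 => if tnth w i then run q1 w else run q0 w
  end.

(* The universe {1, ..., m} is represented by 'I_m = {0, ..., m - 1}. *)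
Record scheme (m n t s : nat) := Scheme {
  store : {S : {set 'I_m} | #|S| <= n} -> s.-tuple bool;
  query : 'I_m -> dtree s;
  query_depth : forall x, depth (query x) <= t;
  query_correct : forall S x, run (query x) (store S) = (x \in val S)
}.

Definition has_scheme (m n t s : nat) : Prop := inhabited (scheme m n t s).

Lemma has_scheme_bitvector (m n t : nat) : 0 < t -> has_scheme m n t m.
Proof.
move=> t_gt0.
pose st (S : {S : {set 'I_m} | #|S| <= n}) := [tuple x \in val S | x < m].
pose qu (x : 'I_m) := Probe x (Answer m false) (Answer m true).
constructor; apply: (@Scheme m n t m st qu) => [x|S x]; first exact: t_gt0.
by rewrite /= tnth_mktuple; case: (x \in _).
Qed.

Lemma ex_has_scheme (m n t : nat) :
  exists s, `[< has_scheme m n t.+1 s >].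
Proof. by exists m; apply/asboolP; exact: has_scheme_bitvector. Qed.

(* Without any probe no scheme exists once m, n > 0, so the minimum is only
   meaningful for t > 0; the value at t = 0 is a dummy. *)
Definition sA (m n t : nat) : nat :=
  if t is t'.+1 then ex_minn (ex_has_scheme m n t') else 0.

Lemma sAP (m n t : nat) : 0 < t ->
  has_scheme m n t (sA m n t) /\
  (forall s, has_scheme m n t s -> sA m n t <= s).
Proof.
case: t => // t _; rewrite /sA; case: ex_minnP => s /asboolP hs min_s.
by split=> // s' /asboolP; exact: min_s.
Qed.

(* Main.v *)
Require Import Defs.
From HB Require Import structures.
From mathcomp Require Import zify ring lra.
From mathcomp Require Import all_boot all_order all_algebra all_fingroup all_field.

(** The universe is laid out on a bipartite graph of girth [g]: every edge [e]
    carries [d] elements. The first probe reads an orientation of the edges, the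
    second one the cell of the element in the block of the vertex [e] points to.
    A set is storable as soon as no edge carrying one of its elements shares its
    head with another edge. If [F] is the set of at most [3g/4] such edges, it
    spans at most [3g/2] vertices, and in a graph of girth [g] a shortest cycle
    together with a longest path outside it shows that some leaf [y] of [F] meets
    all the cycles of the spanned subgraph; orienting the remaining forest away
    from the neighbour of [y] is the required orientation.

    Dense graphs of large girth come from the group generated by the matrices
    [1 + a * sum_(i even) E_(i,i+1)] and [1 + a * sum_(i odd) E_(i,i+1)] of size
    [N] over a field of order [q]: in the coset graph a relation of length [2l]
    would equate two alternating words of length [l] whose entries [(0, l)] are
    nonzero and zero, so the girth is at least [2N]. For [n] in [{8, 9}] the graph
    is the affine part of the split Cayley hexagon, of girth 12. *)

Set Implicit Arguments.
Unset Strict Implicit.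
Unset Printing Implicit Defensive.

Import GRing.Theory.

(** * Cycles, forests and feedback vertices *)

Section Graph.
Variables (T : finType) (adj : rel T).
Hypothesis adj_sym : symmetric adj.
Hypothesis adj_irr : irreflexive adj.

Definition nbrs (Y : {set T}) (x : T) := [set y in Y | adj x y].

(** A cycle is a core and a nonempty core contains a cycle. Unlike cycles, cores are closed under
    union, so a largest one exists. *)
Definition core (Z : {set T}) := [forall x in Z, 1 < #|nbrs Z x|].

Definition cycle_in (Y : {set T}) (p : seq T) :=
  [/\ path.cycle adj p, uniq p, 2 < size p & {subset p <= Y}].

Definition acyclic (Y : {set T}) := forall p, ~ cycle_in Y p.

Lemma acyclicS (Y Z : {set T}) : Z \subset Y -> acyclic Y -> acyclic Z.
Proof.
move=> /subsetP sZY aY p [cp up sp pZ].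
by apply: (aY p); split=> // x /pZ /sZY.
Qed.

Definition path_in (Y : {set T}) (p : seq T) :=
  [/\ sorted adj p, uniq p & {subset p <= Y}].

Lemma path_in_rev Y p : path_in Y p -> path_in Y (rev p).
Proof.
case=> sp up pY; split; first last.
- by move=> x; rewrite mem_rev; exact: pY.
- by rewrite rev_uniq.
by rewrite rev_sorted (eq_sorted (e' := adj)) // => x y /=; rewrite adj_sym.
Qed.

Lemma path_in_size Y p : path_in Y p -> size p <= #|Y|.
Proof. by case=> _ up pY; rewrite cardE uniq_leq_size // => x /pY; rewrite mem_enum. Qed.

Lemma longest_path (Y : {set T}) : Y != set0 -> exists p,
  [/\ path_in Y p, 0 < size p & forall p', path_in Y p' -> size p' <= size p].
Proof.
move=> /set0Pn[x xY].
pose P k := [exists t : k.-tuple T, [&& sorted adj t, uniq t & all (mem Y) t]].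
have PP k : reflect (exists2 p, path_in Y p & size p = k) (P k).
  apply: (iffP existsP) => [[t /and3P[a b /allP c]]|[p [a b c] sp]].
    by exists t; rewrite ?size_tuple.
  have st : size p == k by apply/eqP.
  exists (Tuple st); rewrite /= a b; exact/allP.
have P1 : P 1.
  by apply/PP; exists [:: x] => //; split=> // y; rewrite inE => /eqP->.
have Pb k : P k -> k <= #|Y| by move/PP=> [p /path_in_size ? <-].
have [k /PP[p pP sp] kmax] := ex_maxnP (ex_intro P 1 P1) Pb.
exists p; split=> //; first by rewrite sp kmax.
by move=> p' p'P; rewrite sp kmax //; apply/PP; exists p'.
Qed.

(** A neighbour of the end of a longest path lies on the path, which could be extended otherwise.
    One of two neighbours is not the second vertex, and the edge to it closes a cycle. *)
Lemma path_end_cycle (Y : {set T}) x p : path_in Y (x :: p) ->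
  (forall p', path_in Y p' -> size p' <= size (x :: p)) ->
  1 < #|nbrs Y x| -> exists q, cycle_in Y q.
Proof.
move=> [/= sp /andP[xp up] pY] pmax /card_gt1P[y [z [yN zN nyz]]].
have memp w : w \in nbrs Y x -> w \in p.
  rewrite inE => /andP[wY xw]; apply: contraT => wp.
  have : size [:: w, x & p] <= size (x :: p).
    apply: pmax; split=> /=.
    - by rewrite adj_sym xw.
    - rewrite inE negb_or wp xp up !andbT; apply: contraL xw => /eqP->.
      by rewrite adj_irr.
    - by move=> v; rewrite inE => /predU1P[->|/pY].
  by rewrite /= ltnn.
wlog: y z yN zN nyz / y != head x p.
  move=> H; have [e|] := eqVneq y (head x p); last exact: (H y z).
  by apply: (H z y) => //; rewrite 1?eq_sym // -e.
move=> yh; have yp := memp _ yN.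
case/splitPr: yp sp xp up pY yh => p1 p2 sp xp up pY yh.
exists (x :: rcons p1 y); split.
- rewrite /= rcons_path last_rcons; move: sp.
  rewrite -cat_rcons cat_path => /andP[-> _] /=.
  by move: yN; rewrite inE adj_sym => /andP[].
- rewrite /=; move: xp up; rewrite -cat_rcons mem_cat negb_or cat_uniq.
  by move=> /andP[-> _] /and3P[].
- by rewrite /= size_rcons; case: p1 yh {sp xp up pY} => //=; rewrite eqxx.
- move=> w wp; apply: pY; move: wp; rewrite -cat_rcons !inE mem_cat.
  by case/orP=> ->; rewrite ?orbT.
Qed.

(** At most one end of a longest path is the exceptional vertex [z]. Contrapositively, a forest has
    a vertex of degree at most one other than a prescribed one. *)
Lemma min_degree_cycle (Y : {set T}) (z : T) :
  Y :\ z != set0 -> (forall x, x \in Y :\ z -> 1 < #|nbrs Y x|) ->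
  exists p, cycle_in Y p.
Proof.
move=> /set0Pn[v vY] H.
have Y0 : Y != set0 by apply/set0Pn; exists v; case/setD1P: vY.
have [p [pP p0 pmax]] := longest_path Y0.
have p1 : 1 < size p.
  have /card_gt0P[w wv] : 0 < #|nbrs Y v| by rewrite ltnW ?H.
  apply: (pmax [:: v; w]); move: wv vY; rewrite !inE => /andP[wY vw] /andP[_ vY].
  split=> /=; first by rewrite vw.
    by rewrite inE andbT; apply: contraL vw => /eqP->; rewrite adj_irr.
  by move=> u; rewrite !inE => /orP[] /eqP->.
case: p pP p0 p1 pmax => // x p pP _ p1 pmax.
have [xz|nxz] := eqVneq x z; last first.
  apply: (path_end_cycle pP pmax); apply: H; rewrite !inE nxz.
  by case: pP => _ _ ->; rewrite ?mem_head.
case/lastP: p pP p1 pmax => // p y pP p1 pmax.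
have := path_in_rev pP; rewrite -rcons_cons rev_rcons => qP.
apply: (path_end_cycle qP).
  by move=> p' /pmax; rewrite /= size_rev /= size_rcons.
apply: H; case: qP pP => _ _ qY [_ + _]; rewrite !inE qY ?mem_head // andbT.
rewrite -xz cons_uniq mem_rcons inE negb_or eq_sym => /andP[/andP[]] //.
Qed.

Lemma cycle_nbrs (Y : {set T}) p x : cycle_in Y p -> x \in p ->
  1 < #|nbrs [set y in p] x|.
Proof.
move=> [cp up sp _] xp; apply/card_gt1P; exists (next p x), (prev p x).
rewrite !inE mem_next mem_prev xp (next_cycle cp xp) adj_sym (prev_cycle cp xp).
split=> //; apply/eqP => e.
have : next p (next p x) = x by rewrite e next_prev.
case: p cp up sp xp e => [|a [|b [|c p]]] //= cp up _ xp _.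
have : iter 2 (next [:: a, b, c & p]) x = x -> False; last by move=> H /H.
have [i q E] := rot_to xp.
rewrite -(eq_iter (f := next (rot i [:: a, b, c & p]))); last first.
  by move=> y; rewrite next_rot.
have sq : size q = (size p).+2.
  by move: (congr1 size E); rewrite size_rot /= => -[].
have uq : uniq (x :: q) by rewrite -E rot_uniq.
rewrite E; case: q sq uq {E} => [|y [|w q]] //= _.
rewrite !inE !negb_or !eqxx => /and3P[/and3P[xy xw _] /andP[yw _] _].
by rewrite eq_sym (negPf xy) => e; rewrite e eqxx in xw.
Qed.

Lemma acyclic_core (Y Z : {set T}) : Z \subset Y -> Z != set0 -> core Z -> ~ acyclic Y.
Proof.
move=> sZY /set0Pn[z zZ] /forall_inP cZ aY.
have aZ := acyclicS sZY aY.
have [Zz|Zz] := eqVneq (Z :\ z) set0.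
  have /card_gt0P[w] : 0 < #|nbrs Z z| by rewrite ltnW ?cZ.
  rewrite inE => /andP[wZ zw]; have : w \in Z :\ z.
    by rewrite !inE wZ andbT; apply: contraL zw => /eqP->; rewrite adj_irr.
  by rewrite Zz inE.
have [|p cp] := @min_degree_cycle Z z Zz; last exact: (aZ p).
by move=> x /setD1P[_ /cZ].
Qed.

Lemma acyclic_no_core (Y : {set T}) :
  (forall Z : {set T}, Z \subset Y -> core Z -> Z = set0) -> acyclic Y.
Proof.
move=> H p cp; have : [set y in p] = set0.
  apply: H; first by apply/subsetP => x; rewrite inE; case: cp => _ _ _; exact.
  by apply/forall_inP => x; rewrite inE; exact: (cycle_nbrs cp).
case: cp; case: p => // x p _ _ _ _ /setP /(_ x).
by rewrite !inE eqxx.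
Qed.

(** Vertices of degree at most one other than [z] are removed in turn, each ranked above all that
    remain, so [z] gets the least rank. A vertex has at most one neighbour left when it is removed,
    the only one of smaller rank. *)
Lemma elimination_order (Y : {set T}) (z : T) : z \in Y -> acyclic Y ->
  exists r : T -> nat, [/\ {in Y &, injective r}, {in Y, forall x, r z <= r x} &
    {in Y & &, forall x y y', adj x y -> adj x y' -> r y < r x -> r y' < r x ->
       y = y'}].
Proof.
have [n] := ubnP #|Y|; elim: n Y => // n IH Y leYn zY aY.
have [Y0|Y0] := eqVneq (Y :\ z) set0.
  have Yz x : x \in Y -> x = z.
    move=> xY; apply/eqP; apply: contraT => nxz.
    by have := in_set0 x; rewrite -Y0 !inE nxz xY.
  exists (fun=> 0); split=> [x y /Yz-> /Yz-> //|//|x y y' /Yz-> /Yz->].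
  by rewrite adj_irr.
have [v vY vN] : exists2 v, v \in Y :\ z & #|nbrs Y v| <= 1.
  apply/exists_inP; apply: contraT => /exists_inPn H.
  have [|p cp] := min_degree_cycle Y0; last by case: (aY p).
  by move=> x /H; rewrite -ltnNge.
have [vz vY'] := setD1P vY.
have [||r [ri rz r1]] := IH (Y :\ v) _ _ (acyclicS (subsetDl _ _) aY).
- by move: leYn; rewrite [#|Y|](cardsD1 v) vY'.
- by rewrite !inE eq_sym vz.
pose M := (\max_x r x).+1; pose r' x := if x == v then M else r x.
have rM x : r x < M by rewrite ltnS leq_bigmax.
exists r'; split.
- move=> x y xY yY; rewrite /r'; case: eqVneq => [->|xv]; case: eqVneq => [->|yv] //.
  + by move=> e; have := rM y; rewrite -e ltnn.
  + by move=> e; have := rM x; rewrite e ltnn.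
  + by apply: ri; rewrite !inE ?xv ?yv.
- move=> x xY; rewrite /r' [z == v]eq_sym (negPf vz); case: eqVneq => [_|xv].
    exact: ltnW.
  by apply: rz; rewrite !inE xv.
move=> x y y' xY yY y'Y xy xy'; rewrite /r'; case: (eqVneq x v) => [xv|xv].
  rewrite xv in xy xy' *; move=> _ _; by apply: (card_le1_eqP vN); rewrite inE ?yY ?y'Y.
case: (eqVneq y v) => [_|yv]; first by rewrite ltnNge ltnW.
case: (eqVneq y' v) => [_ _|y'v]; first by rewrite ltnNge ltnW.
by apply: r1; rewrite ?inE ?xv ?yv ?y'v.
Qed.

End Graph.

(** * Ears of a shortest cycle, and vertices meeting all cycles *)

Lemma head_rev (T : Type) (x : T) (s : seq T) : head x (rev s) = last x s.
Proof. by case/lastP: s => // s y; rewrite rev_rcons last_rcons. Qed.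

Lemma last_rev (T : Type) (x : T) (s : seq T) : last x (rev s) = head x s.
Proof. by rewrite -head_rev revK. Qed.

Lemma next_nth_modn (T : eqType) (x0 : T) p k : uniq p -> k < size p ->
  next p (nth x0 p k) = nth x0 p (k.+1 %% size p).
Proof.
move=> up kp; rewrite next_nth mem_nth //.
case: p up kp => // y p up kp; rewrite index_uniq //.
move: kp; rewrite leq_eqVlt => /predU1P[h|h]; last first.
  by rewrite (modn_small h) /=; apply: set_nth_default.
by rewrite h modnn /= nth_default //; case: h => ->.
Qed.

Section Ears.
Variables (T : finType) (adj : rel T).
Hypothesis adj_sym : symmetric adj.
Hypothesis adj_irr : irreflexive adj.
Local Notation nbrs := (nbrs adj).
Local Notation core := (core adj).
Local Notation cycle_in := (cycle_in adj).
Local Notation path_in := (path_in adj).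
Local Notation acyclic := (acyclic adj).

Lemma small_acyclic (X Z : {set T}) g : (forall p, cycle_in X p -> g <= size p) ->
  Z \subset X -> #|Z| < g -> acyclic Z.
Proof.
move=> gX /subsetP sZX Zg p [cp up sp pZ].
have : g <= size p by apply: gX; split=> // x /pZ /sZX.
rewrite leqNgt (leq_ltn_trans _ Zg) // cardE uniq_leq_size // => x /pZ.
by rewrite mem_enum.
Qed.

Lemma shortest_cycle (X : {set T}) p : cycle_in X p ->
  exists2 p', cycle_in X p' & forall q, cycle_in X q -> size p' <= size q.
Proof.
move=> pX.
pose P k := [exists t : k.-tuple T,
  [&& path.cycle adj t, uniq t, 2 < size t & all (mem X) t]].
have PP k : reflect (exists2 p, cycle_in X p & size p = k) (P k).
  apply: (iffP existsP) => [[t /and4P[a b c /allP d]]|[q [a b c d] sq]].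
    by exists t; rewrite ?size_tuple.
  have st : size q == k by apply/eqP.
  exists (Tuple st); apply/and4P; split=> //; exact/allP.
have P1 : P (size p) by apply/PP; exists p.
have [k /PP[q qX <-] kmin] := ex_minnP (ex_intro P _ P1).
by exists q => // q' q'X; apply: kmin; apply/PP; exists q'.
Qed.

Lemma path_in_fork (Y : {set T}) t1 x t2 s : path_in Y (t1 ++ x :: t2) ->
  path_in Y (x :: s) -> {in s, forall y, y \notin t1} -> path_in Y (t1 ++ x :: s).
Proof.
move=> [st ut tY] [ss us sY] dst; split.
- by case: t1 st {ut tY dst} => //= y t1; rewrite !cat_path /= => /and3P[-> -> _].
- move: ut; rewrite !cat_uniq us => /and3P[-> nt _]; rewrite /= andbT.
  move: nt => /=; rewrite !negb_or => /andP[-> _] /=; apply/hasPn => y ys.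
  exact: dst.
- move=> y; rewrite mem_cat => /orP[yt|/sY //]; apply: tY.
  by rewrite mem_cat yt.
Qed.

Section ShortestCycle.
Variables (X : {set T}) (p : seq T) (x0 : T).
Hypothesis p_cycle : cycle_in X p.
Hypothesis p_min : forall q, cycle_in X q -> size p <= size q.
Let g := size p.
(** Indices are read modulo [g], so that the two arcs between [c i] and [c j] become the intervals
    from [i] to [j] and from [j] to [i + g]. *)
Let c i := nth x0 p (i %% g).

Local Lemma g_gt2 : 2 < g. Proof. by case: p_cycle. Qed.

Local Lemma g_gt0 : 0 < g. Proof. exact: ltn_trans g_gt2. Qed.

Local Lemma cDg i : c (i + g) = c i. Proof. by rewrite /c modnDr. Qed.

Local Lemma c_mem i : c i \in p.
Proof. by rewrite mem_nth // ltn_mod g_gt0. Qed.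

Local Lemma c_ex x i : x \in p -> exists2 j, i <= j < i + g & x = c j.
Proof.
move=> xp; have := index_mem x p; rewrite xp => lx; rewrite -/g in lx.
exists (i + (index x p + g - i %% g) %% g).
  by rewrite leq_addr ltn_add2l ltn_mod g_gt0.
rewrite /c; suff -> : (i + (index x p + g - i %% g) %% g) %% g = index x p.
  by rewrite nth_index.
rewrite modnDmr {1}(divn_eq i g) -addnA modnMDl subnKC; last first.
  by rewrite (leq_trans (ltnW (ltn_pmod i g_gt0))) ?leq_addl.
by rewrite modnDr modn_small.
Qed.

Local Lemma c_inj i j k : i <= j < i + g -> i <= k < i + g -> c j = c k -> j = k.
Proof.
case: p_cycle => _ up _ _ ij ik /eqP.
rewrite /c nth_uniq ?ltn_mod ?g_gt0 //.
wlog jk : j k ij ik / j <= k.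
  by move=> H; case: (leqP j k) => [/H|/ltnW /H]; [exact|move=> h; rewrite eq_sym => /h ->].
rewrite eq_sym eqn_mod_dvd // => /dvdnP[q e].
case: q e => [|q]; lia.
Qed.

Local Lemma c_adj i : adj (c i) (c i.+1).
Proof.
have gp := g_gt0.
case: p_cycle => cp up _ _; have := next_cycle cp (c_mem i).
rewrite /c next_nth_modn ?ltn_mod // .
by rewrite -addn1 modnDml addn1.
Qed.

Local Notation Y := (X :\: [set x in p]).

(** The arc and the outside path [q] close up to a cycle, which cannot be shorter than [p]. The
    bound by 2 excludes only [i = j] with [q] a single vertex. *)
Local Lemma ear i j q : i <= j < i + g -> path_in Y q -> q != [::] ->
  adj (c i) (head x0 q) -> adj (last x0 q) (c j) -> 2 < (j - i).+1 + size q ->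
  g <= (j - i).+1 + size q.
Proof.
move=> ijg; suff H q' : path_in Y q' -> q' != [::] -> adj (c j) (head x0 q') ->
    adj (last x0 q') (c i) -> 2 < (j - i).+1 + size q' ->
    g <= (j - i).+1 + size q'.
  move=> qY q0 iq qj sq; rewrite -(size_rev q); apply: H.
  - exact: (path_in_rev adj_sym).
  - by rewrite -size_eq0 size_rev size_eq0.
  - by rewrite head_rev adj_sym.
  - by rewrite last_rev adj_sym.
  - by rewrite size_rev.
move: q' => {}q [sq uq qY] q0 jq qi s2.
pose r := [seq c k | k <- iota i (j - i).+1].
have sr : size r = (j - i).+1 by rewrite size_map size_iota.
rewrite -sr -size_cat; apply: p_min; split.
- have pr k n : path adj (c k) [seq c l | l <- iota k.+1 n].
    by elim: n k => //= n IH k; rewrite c_adj IH.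
  have lr k n : last (c k) [seq c l | l <- iota k.+1 n] = c (k + n).
    by elim: n k => [|n IH] k /=; rewrite ?addn0 // IH addnS.
  case: q jq qi sq q0 {uq qY s2} => //= a q jq qi sq _.
  rewrite rcons_cat cat_path pr lr subnKC; last by case/andP: ijg.
  by rewrite /= jq rcons_path sq.
- rewrite cat_uniq uq andbT; apply/andP; split.
    rewrite map_inj_in_uniq ?iota_uniq // => k l; rewrite !mem_iota => hk hl.
    by apply: (@c_inj i); move: ijg hk hl; lia.
  apply/hasPn => y /qY; rewrite !inE => /andP[yp _]; apply/negP => yr.
  have /mapP[k _ yk] : y \in [seq c k | k <- iota i (j - i).+1] by [].
  by rewrite yk c_mem in yp.
- by rewrite size_cat sr.
- move=> y; rewrite /r mem_cat => /orP[/mapP[k _ ->]|/qY /setDP[]//].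
  by case: p_cycle => _ _ _; apply; exact: c_mem.
Qed.

Hypothesis g_gt4 : 4 < g.
Hypothesis X_small : 2 * #|X| <= 3 * g.

Local Lemma card_Y : #|Y| + g = #|X|.
Proof.
case: p_cycle => _ up _ pX.
have e : #|[set x in p]| = g by rewrite cardsE; apply/card_uniqP.
rewrite cardsD (setIidPr _) ?e ?subnK //; last by apply/subsetP => x; rewrite inE => /pX.
by rewrite -e; apply/subset_leq_card/subsetP => x; rewrite inE => /pX.
Qed.

Local Lemma path_size q : path_in Y q -> 2 * size q <= g.
Proof. by move/path_in_size; have := card_Y; lia. Qed.

(** The feet [d] and [d'] cut the cycle into two arcs. Each closes a cycle with [w], so
    [2 * g <= g + 4], against [4 < g]. *)
Local Lemma two_attachments w d d' : w \in Y -> d \in p -> d' \in p -> d != d' ->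
  adj w d -> adj w d' -> False.
Proof.
move=> wY dp d'p ndd' wd wd'.
have [l _ el] := c_ex 0 dp; have [l' /andP[ll' l'g] el'] := c_ex l d'p.
have {}ll' : l < l'.
  by rewrite ltn_neqAle ll' andbT; apply: contra ndd' => /eqP e; rewrite el el' e.
have wP : path_in Y [:: w] by split=> // x; rewrite inE => /eqP->.
have e1 : g <= (l' - l).+1 + size [:: w].
  by apply: ear => //=; rewrite -?el -?el' // 1?adj_sym //; lia.
have e2 : g <= (l + g - l').+1 + size [:: w].
  by apply: ear => //=; rewrite ?cDg -?el -?el' // 1?adj_sym //; lia.
move: e1 e2 => /=; move: g_gt4; lia.
Qed.

Section Ear.
Variables (i j : nat) (t : seq T).
Hypotheses (ij : i < j < i + g) (tY : path_in Y t) (t0 : t != [::]).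
Hypotheses (it : adj (c i) (head x0 t)) (tj : adj (last x0 t) (c j)).

(** Both arcs between the feet close a cycle with the ear [t]. As they have [g] edges together,
    neither has more than [(size t).+1]. *)
Local Lemma ear_arcs : g <= j - i + (size t).+1 /\ j - i <= (size t).+1.
Proof.
have t1 : 0 < size t by case: (t) t0.
split; first by rewrite addnS -addSn; apply: ear => //; lia.
have : g <= ((i + g) - j).+1 + size t; last lia.
rewrite -size_rev; apply: ear => //; try lia.
- exact: (path_in_rev adj_sym).
- by rewrite -size_eq0 size_rev size_eq0.
- by rewrite head_rev adj_sym.
- by rewrite last_rev cDg adj_sym.
- by rewrite size_rev; lia.
Qed.

(* A path leaving the ear and reaching the cycle splits the union of the two
   into two shorter cycles. *)
Local Lemma ear_attach t1 x t2 s l : t = t1 ++ x :: t2 -> path_in Y (x :: s) ->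
  {in s, forall y, y \notin t} -> adj (last x s) (c l) -> i <= l < i + g ->
  0 < size s \/ ~ (t1 = [::] /\ l = i) -> 0 < size s \/ ~ (t2 = [::] /\ l = j) ->
  g <= size t + 2 + size s.
Proof.
move=> et sY st xl il h1 h2.
have [arc1 arc2] := ear_arcs.
have f1 : path_in Y (t1 ++ x :: s).
  apply: (@path_in_fork _ _ _ t2) => //; first by rewrite -et.
  by move=> y /st; rewrite et mem_cat negb_or => /andP[].
have f2 : path_in Y (rev t2 ++ x :: s).
  apply: (@path_in_fork _ _ _ (rev t1)) => //.
    have := path_in_rev adj_sym tY.
    by rewrite et rev_cat rev_cons -cats1 -catA.
  move=> y /st; rewrite et mem_cat inE mem_rev !negb_or.
  by case/and3P.
have hd1 : head x0 (t1 ++ x :: s) = head x0 t by rewrite et; case: (t1).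
have hd2 : head x0 (rev t2 ++ x :: s) = last x0 t.
  rewrite et last_cat /=; case/lastP: t2 {et h2 f2} => // t2 y.
  by rewrite rev_rcons last_rcons.
have ls1 u : last x0 (u ++ x :: s) = last x s by rewrite last_cat.
have n0 u : u ++ x :: s != [::] by case: u.
have h1' : 0 < size s + size t1 + (l - i).
  case: h1 => [|h1]; first lia.
  rewrite lt0n; apply/eqP => h; apply: h1; split; last lia.
  by apply/nilP; rewrite /nilp; lia.
have h2' : 0 < size s + size t2 + (l - j) + (j - l).
  case: h2 => [|h2]; first lia.
  rewrite lt0n; apply/eqP => h; apply: h2; split; last lia.
  by apply/nilP; rewrite /nilp; lia.
have st' : size t = size t1 + (size t2).+1 by rewrite et size_cat.
(* The foot [c l] splits one of the two arcs between [c i] and [c j]. Either arc has at most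
   [(size t).+1] edges, so the bounds for the two new cycles add up to twice the claim. *)
have [lj|jl] := leqP l j.
  have e1 : g <= (l - i).+1 + size (t1 ++ x :: s).
    apply: ear => //; rewrite ?hd1 ?ls1 // size_cat /=; lia.
  have e2 : g <= (j - l).+1 + size (rev (rev t2 ++ x :: s)).
    apply: ear; rewrite ?head_rev ?last_rev ?hd2 ?ls1 //.
    - lia.
    - exact: (path_in_rev adj_sym).
    - by rewrite -size_eq0 size_rev size_eq0.
    - by rewrite adj_sym.
    - by rewrite size_rev size_cat size_rev /=; lia.
  move: e1 e2; rewrite size_rev !size_cat size_rev /=; lia.
have e1 : g <= (i + g - l).+1 + size (rev (t1 ++ x :: s)).
  apply: ear; rewrite ?head_rev ?last_rev ?hd1 ?ls1 ?cDg //.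
  - lia.
  - exact: (path_in_rev adj_sym).
  - by rewrite -size_eq0 size_rev size_eq0.
  - by rewrite adj_sym.
  - by rewrite adj_sym.
  - by rewrite size_rev size_cat /=; lia.
have e2 : g <= (l - j).+1 + size (rev t2 ++ x :: s).
  apply: ear; rewrite ?hd2 ?ls1 //; try lia; first by rewrite adj_sym.
  by rewrite size_cat size_rev /=; lia.
move: e1 e2; rewrite size_rev !size_cat size_rev /=; lia.
Qed.

(** Any further edge from the ear to the cycle gives [g <= size t + 2] by [ear_attach], against
    [2 * size t <= g] and [4 < g]. The first alternative forgets [x] because [c i] is the vertex to
    be deleted. *)
Local Lemma ear_chord x d : x \in t -> d \in p -> adj x d ->
  d = c i \/ x = last x0 t /\ d = c j.
Proof.
move=> xt dp xd; have [l il el] := c_ex i dp.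
have [t1 [t2 et]] : exists t1 t2, t = t1 ++ x :: t2.
  by case/splitPr: xt => t1 t2; exists t1, t2.
case: (boolP ((t1 == [::]) && (l == i))) => [/andP[_ /eqP li]|n1].
  by left; rewrite el li.
case: (boolP ((t2 == [::]) && (l == j))) => [/andP[/eqP t20 /eqP lj]|n2].
  by right; rewrite el lj et t20 last_cat.
have : g <= size t + 2 + size (Nil T).
  apply: (ear_attach et _ _ _ il) => //; first last.
  - by right=> -[e1 e2]; rewrite e1 e2 !eqxx in n2.
  - by right=> -[e1 e2]; rewrite e1 e2 !eqxx in n1.
  - by rewrite -el.
  - by split=> // y; rewrite inE => /eqP->; case: tY => _ _; apply.
by have := path_size tY; have := g_gt4; rewrite /=; lia.
Qed.

Local Lemma uniq_outside q : uniq q -> {subset q <= Y} -> {in q, forall x, x \notin t} ->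
  2 * (size t + size q) <= g.
Proof.
move=> uq qY qt; rewrite -size_cat; case: tY => _ ut tY'.
have : size (t ++ q) <= #|Y|.
  rewrite cardE uniq_leq_size //.
    by rewrite cat_uniq ut uq andbT; apply/hasPn => x /qt.
  by move=> x; rewrite mem_enum mem_cat => /orP[/tY'|/qY].
by have := card_Y; lia.
Qed.

Local Lemma ear_outside w x d : w \in Y -> w \notin t -> x \in t -> d \in p ->
  adj w x -> adj w d -> False.
Proof.
move=> wY wt xt dp wx wd; have [l il el] := c_ex i dp.
have [t1 [t2 et]] : exists t1 t2, t = t1 ++ x :: t2.
  by case/splitPr: xt => t1 t2; exists t1, t2.
have : g <= size t + 2 + size [:: w].
  apply: (ear_attach et _ _ _ il); rewrite ?orTb; first last.
  - by left.
  - by left.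
  - by rewrite /= -el.
  - by move=> y; rewrite inE => /eqP->.
  - split=> /=; first by rewrite adj_sym wx.
      by rewrite inE andbT; apply: contra wt => /eqP <-.
    move=> y; rewrite !inE => /orP[] /eqP->; last by move: wY; rewrite !inE.
    by case: tY => _ _ /(_ _ xt); rewrite !inE.
have : 2 * (size t + size [:: w]) <= g.
  by apply: uniq_outside => // y; rewrite inE => /eqP->.
by have := g_gt4; rewrite /=; lia.
Qed.

(** A nonempty core [Z] avoiding [c i] has a vertex [v] off the cycle, other than the end of the
    ear, with at most one neighbour in [Z] off the cycle. So [v] is joined to the cycle, hence is
    not on the ear, and its second neighbour is on neither; too few vertices then remain for the
    ear. *)
Local Lemma ear_acyclic : acyclic (X :\ c i).
Proof.
apply: (acyclic_no_core adj_sym) => Z sZ cZ; apply/eqP; apply: contraT => Z0.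
have sZX : Z \subset X by apply: subset_trans sZ _; exact: subsetDl.
have YX : #|Y| < g by have := card_Y; have := g_gt4; lia.
have ciZ : c i \notin Z.
  by apply/negP => /(subsetP sZ); rewrite !inE eqxx.
have Zcase x : x \in Z -> x \in p \/ x \in Z :&: Y.
  move=> xZ; rewrite !inE xZ (subsetP sZX _ xZ) andbT /=.
  by case: (x \in p); [left|right].
have nZ x : x \in Z -> 1 < #|nbrs Z x| by move=> xZ; exact: (forall_inP cZ).
have lt : last x0 t \in t by case: (t) t0 => //= y q _; exact: mem_last.
(* First case: off the cycle [Z] has at most the end of the ear, whose only possible neighbour in
   [Z] is [c j]; without it [Z] lies on the cycle minus [c i]. *)
have [Z2|Z2] := eqVneq (Z :&: Y :\ last x0 t) set0.
  have Zl x : x \in Z :&: Y -> x = last x0 t.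
    move=> xZ; apply/eqP; apply: contraT => nx.
    by have := in_set0 x; rewrite -Z2 in_setD1 nx xZ.
  have [Zp|/subsetPn[x xZ xp]] := boolP (Z \subset [set x in p]).
    have : acyclic Z.
      apply: (small_acyclic p_min) => //; rewrite -/g.
      have : Z \subset [set x in p] :\ c i.
        apply/subsetP => x xZ; rewrite in_setD1 (subsetP Zp) // andbT.
        by apply: contraNneq ciZ => <-.
      move/subset_leq_card/leq_ltn_trans; apply.
      have := cardsD1 (c i) [set x in p]; rewrite inE c_mem.
      have -> : #|[set x in p]| = g.
        by case: p_cycle => _ up _ _; rewrite cardsE; apply/card_uniqP.
      by move=> ->.
    by move=> aZ; case: (acyclic_core adj_sym adj_irr (subxx _) Z0 cZ aZ).
  have xY : x \in Z :&: Y by case: (Zcase _ xZ) => // h; rewrite inE h in xp.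
  have ex := Zl _ xY; have /card_gt1P[d [d' [dN d'N dd']]] := nZ _ xZ.
  have dj y : y \in nbrs Z x -> y = c j.
    rewrite inE => /andP[yZ xy]; have [yp|/Zl ey] := Zcase _ yZ.
      have [e|[]//] : y = c i \/ x = last x0 t /\ y = c j.
        by apply: ear_chord => //; rewrite ex.
      by rewrite -e yZ in ciZ.
    by rewrite ex ey adj_irr in xy.
  by rewrite (dj _ dN) (dj _ d'N) eqxx in dd'.
have [v vZ vN] : exists2 v, v \in Z :&: Y :\ last x0 t & #|nbrs (Z :&: Y) v| <= 1.
  apply/exists_inP; apply: contraT => /exists_inPn H.
  have [|q cq] := min_degree_cycle adj_sym adj_irr Z2.
    by move=> x /H; rewrite -ltnNge.
  have aZ : acyclic (Z :&: Y).
    apply: (small_acyclic p_min); first by apply: subset_trans sZX; exact: subsetIl.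
    by rewrite (leq_ltn_trans _ YX) // subset_leq_card // subsetIr.
  by case: (aZ q).
have [vl vZY] := setD1P vZ; have [vZ' vY] := setIP vZY.
have [d dZ vd] : exists2 d, d \in Z & (d \in p) && adj v d.
  apply/exists_inP; apply: contraT => /exists_inPn H.
  have := nZ _ vZ'; rewrite ltnNge (leq_trans _ vN) // subset_leq_card //.
  apply/subsetP => y; rewrite !inE => /andP[yZ vy].
  have := H _ yZ; rewrite vy andbT => yp.
  by rewrite yZ yp (subsetP sZX _ yZ).
have /andP[dp {}vd] := vd.
have vt : v \notin t.
  apply/negP => vt; have [e|[e _]] := ear_chord vt dp vd.
    by rewrite -e dZ in ciZ.
  by rewrite e eqxx in vl.
have /card_gt1P[y [y' [yN y'N yy']]] := nZ _ vZ'.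
wlog nyd : y y' yN y'N yy' / y != d.
  move=> H; have [e|] := eqVneq y d; last exact: (H y y').
  by apply: (H y' y) => //; rewrite 1?eq_sym // -e.
move: yN; rewrite inE => /andP[yZ vy]; have [yp|] := Zcase _ yZ.
  by case: (two_attachments vY yp dp nyd vy vd).
case/setIP=> _ yY; have [yt|yt] := boolP (y \in t).
  by case: (ear_outside vY vt yt dp vy vd).
(* This says [2 * size t + 4 <= g], while [ear_arcs] gives [g <= 2 * size t + 2]. *)
have : 2 * (size t + size [:: v; y]) <= g.
  apply: uniq_outside => /=.
  - by rewrite inE andbT; apply: contraL vy => /eqP->; rewrite adj_irr.
  - by move=> x; rewrite inE => /predU1P[->//|]; rewrite inE => /eqP->.
  - by move=> x; rewrite inE => /predU1P[->//|]; rewrite inE => /eqP->.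
move=> h3; have [h1 h2] := ear_arcs.
by move: h1 h2 h3; clear; rewrite /= -/g; move: (size t) (j - i) g; lia.
Qed.

End Ear.

(** If the largest core [X'] is the cycle itself, any of its vertices in [L] will do. Otherwise a
    longest path of [X'] off the cycle is an ear, and deleting either foot breaks all cycles. If
    both feet were outside [L], then [#|X| + 2 <= 2 * f] would leave the ear at most [g / 2 - 2]
    vertices, too few for [ear_arcs]. *)
Local Lemma feedback_cycle (L : {set T}) f : L \subset X ->
  #|X| + #|X :\: L| <= 2 * f -> 4 * f <= 3 * g ->
  exists2 y, y \in L & acyclic (X :\ y).
Proof.
move=> sLX Xf fg; have pX : {subset p <= X} by case: p_cycle.
pose X' := \bigcup_(Z : {set T} | (Z \subset X) && core Z) Z.
have sX' : X' \subset X by apply/bigcupsP => Z /andP[].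
have X'max (Z : {set T}) : Z \subset X -> core Z -> Z \subset X'.
  by move=> h1 h2; apply: bigcup_sup; rewrite h1.
have cX' : core X'.
  apply/forall_inP => x /bigcupP[Z /andP[sZ cZ] xZ].
  rewrite (leq_trans (forall_inP cZ _ xZ)) // subset_leq_card //.
  apply/subsetP => y; rewrite !inE => /andP[yZ ->]; rewrite andbT.
  exact: (subsetP (X'max _ sZ cZ)).
have p_core : core [set x in p].
  by apply/forall_inP => x; rewrite inE => /(cycle_nbrs adj_sym p_cycle).
have pX' : {subset p <= X'}.
  move=> x xp; apply: (subsetP (X'max [set x in p] _ p_core)); rewrite ?inE //.
  by apply/subsetP => y; rewrite inE => /pX.
have cp : #|[set x in p]| = g.
  by case: p_cycle => _ up _ _; rewrite cardsE; apply/card_uniqP.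
have YX : #|Y| < g by have := card_Y; have := g_gt4; lia.
have [Y0|Y0] := eqVneq (X' :\: [set x in p]) set0.
  have [y0 /andP[y0p y0L]] : exists y, (y \in p) && (y \in L).
    apply/existsP; apply: contraT => /existsPn H.
    have : #|[set x in p]| <= #|X :\: L|.
      apply/subset_leq_card/subsetP => x; rewrite !inE => xp; rewrite (pX _ xp) andbT.
      by have := H x; rewrite xp.
    by rewrite cp; have := card_Y; have := g_gt4; lia.
  exists y0 => //; apply: (acyclic_no_core adj_sym) => Z sZ cZ; apply/eqP; apply: contraT => Z0.
  have sZX : Z \subset X by apply: subset_trans sZ _; exact: subsetDl.
  have : acyclic Z.
    apply: (small_acyclic p_min) => //; rewrite -/g.
    have : Z \subset [set x in p] :\ y0.
      apply/subsetP => x xZ; move: (subsetP sZ _ xZ); rewrite !in_setD1 => /andP[-> _] /=.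
      have xX' := subsetP (X'max _ sZX cZ) _ xZ.
      by have := in_set0 x; rewrite -Y0 in_setD xX' andbT => /negbFE.
    move/subset_leq_card/leq_ltn_trans; apply.
    by have := cardsD1 y0 [set x in p]; rewrite inE y0p cp => ->.
  by move=> aZ; case: (acyclic_core adj_sym adj_irr (subxx _) Z0 cZ aZ).
have [t [tY' t0 tmax]] := longest_path adj Y0.
have sY' : X' :\: [set x in p] \subset Y by apply: setSD.
have tY : path_in Y t by case: tY' => ? ? tY'; split=> // x /tY' /(subsetP sY').
have aY' : acyclic (X' :\: [set x in p]).
  apply: (small_acyclic p_min); first exact: subset_trans (subsetDl _ _) sX'.
  exact: leq_ltn_trans (subset_leq_card sY') YX.
have attach q : path_in (X' :\: [set x in p]) q -> size q = size t ->
    exists2 d, d \in p & adj (head x0 q) d.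
  case: q => [|x q] qY sq; first by rewrite -sq in t0.
  have xX' : x \in X' by case: qY => _ _ /(_ x (mem_head _ _)) /setDP[].
  have xN : #|nbrs (X' :\: [set x in p]) x| <= 1.
    rewrite leqNgt; apply/negP => H.
    have [|r /aY' //] := path_end_cycle adj_sym adj_irr qY _ H.
    by rewrite sq.
  apply/exists_inP; apply: contraT => /exists_inPn H.
  have := forall_inP cX' _ xX'; rewrite ltnNge (leq_trans _ xN) // subset_leq_card //.
  apply/subsetP => y; rewrite !inE /= => /andP[-> xy]; rewrite xy !andbT.
  by apply: contraL xy => /H.
have [d dp td] := attach _ tY' erefl.
have [d' d'p [t'd dd']] : exists2 d', d' \in p & adj (last x0 t) d' /\ d != d'.
  (* For a single vertex the second foot is another neighbour in [X'], on the cycle since the path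
     is longest. For a longer path, a common foot of both ends would close a cycle shorter than
     [g]. *)
  have [t1|t1] := leqP (size t) 1.
    case: t t0 t1 {tY attach} td tmax tY' => [|x [|]] //= _ _ xd tmax [_ _ tY'].
    have /setDP[xX' xp] := tY' x (mem_head _ _).
    have : 0 < #|nbrs X' x :\ d|.
      have := forall_inP cX' _ xX'; rewrite (cardsD1 d) inE xd (pX' _ dp).
      by rewrite add1n ltnS.
    case/card_gt0P => y; rewrite !inE eq_sym => /and3P[dy yX' xy].
    exists y => //; apply: contraT => yp.
    have : size [:: y; x] <= 1.
      apply: tmax; split=> /=; first by rewrite adj_sym xy.
        by rewrite inE andbT; apply: contraL xy => /eqP->; rewrite adj_irr.
      move=> z; rewrite !inE => /orP[] /eqP->; first by rewrite yp yX'.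
      by move: xp; rewrite inE => ->.
    by [].
  have [d' d'p] := attach _ (path_in_rev adj_sym tY') (size_rev t).
  rewrite head_rev => td'; exists d' => //; split=> //; apply/eqP => e.
  have [l _ el] := c_ex 0 dp.
  have : g <= (l - l).+1 + size t.
    apply: ear; rewrite ?leqnn -?el ?e //.
    - by have := g_gt4; lia.
    - by rewrite -size_eq0 -lt0n.
    - by rewrite adj_sym -e.
    - by rewrite subnn add1n.
  by have := path_size tY; have := g_gt4; lia.
have [i _ ei] := c_ex 0 dp; have [j /andP[ij jg] ej] := c_ex i d'p.
have {}ij : i < j < i + g.
  rewrite jg andbT ltn_neqAle ij andbT; apply: contra dd' => /eqP e.
  by rewrite ei ej e.
have t00 : t != [::] by rewrite -size_eq0 -lt0n.
have it : adj (c i) (head x0 t) by rewrite -ei adj_sym.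
have tj : adj (last x0 t) (c j) by rewrite -ej.
have [iL|iL] := boolP (c i \in L).
  by exists (c i) => //; exact: (ear_acyclic ij tY t00 it tj).
have [jL|jL] := boolP (c j \in L).
  exists (c j) => //; apply: (@ear_acyclic j (i + g) (rev t)).
  - by have := g_gt4; move: ij; clear; move: g; lia.
  - exact: (path_in_rev adj_sym).
  - by rewrite -size_eq0 size_rev size_eq0.
  - by rewrite head_rev adj_sym.
  - by rewrite last_rev cDg adj_sym.
have : 1 < #|X :\: L|.
  apply/card_gt1P; exists (c i), (c j).
  by rewrite !inE iL jL !pX ?c_mem // -ei -ej.
have [h1 h2] := ear_arcs ij tY t00 it tj.
have := path_in_size tY; have := card_Y; move: Xf fg h1 h2; clear.
by move: #|X| #|Y| #|X :\: L| (size t) (j - i) g; lia.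
Qed.

End ShortestCycle.

(** In the application [f] counts edges, [X] is the set of their ends and [L] the set of ends on a
    single edge. Without a nonempty core any vertex of degree at most one will do; otherwise a
    shortest cycle is available. *)
Lemma feedback_vertex (X L : {set T}) f g : L \subset X -> X != set0 -> 4 < g ->
  {in X, forall x, #|nbrs X x| <= 1 -> x \in L} ->
  #|X| + #|X :\: L| <= 2 * f -> 4 * f <= 3 * g ->
  (forall p, cycle_in X p -> g <= size p) ->
  exists2 y, y \in L & acyclic (X :\ y).
Proof.
move=> sLX X0 g4 leafL Xf fg gX.
have [/exists_inP[Z sZ /andP[Z0 cZ]]|/exists_inPn H] :=
    boolP [exists (Z : {set T} | Z \subset X), (Z != set0) && core Z].
  have /set0Pn[x0 x0Z] := Z0.
  have [p0 p0Z] : exists p, cycle_in Z p.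
    apply: (@min_degree_cycle _ _ adj_sym adj_irr _ x0).
      have /card_gt0P[y] : 0 < #|nbrs Z x0| by rewrite ltnW ?(forall_inP cZ).
      rewrite inE => /andP[yZ xy]; apply/set0Pn; exists y; rewrite !inE yZ andbT.
      by apply: contraL xy => /eqP->; rewrite adj_irr.
    by move=> x /setD1P[_ xZ]; exact: (forall_inP cZ).
  have p0X : cycle_in X p0.
    by case: p0Z => ? ? ? h; split=> // x /h /(subsetP sZ).
  have [p pX pmin] := shortest_cycle p0X.
  have gp := gX _ pX.
  by apply: (@feedback_cycle X p x0 pX pmin _ _ L f) => //; lia.
have aX : acyclic X.
  apply: (acyclic_no_core adj_sym) => Z sZ cZ; apply/eqP; apply: contraT => Z0.
  by have := H Z sZ; rewrite Z0 cZ.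
have [y yX yN] : exists2 y, y \in X & #|nbrs X y| <= 1.
  apply/exists_inP; apply: contraT => /exists_inPn h.
  have cX : core X by apply/forall_inP => x /h; rewrite -ltnNge.
  by case: (acyclic_core adj_sym adj_irr (subxx X) X0 cX).
by exists y; [exact: leafL|apply: acyclicS aX; exact: subsetDl].
Qed.
End Ears.

(** * Orientations of bipartite graphs *)

Section BipartiteGraph.
Variables (E V1 V2 : finType) (u : E -> V1) (v : E -> V2).

(** Closed walks without backtracking are given by their edges alone, which suits group relations
    and coordinates alike. For [2 < g] the case [l = 1] forbids parallel edges. *)
Definition girth_geq g := forall (l : nat) (e : nat -> E), 0 < l -> l.*2 < g ->
  (forall i, i < l ->
    [/\ u (e i.*2) = u (e i.*2.+1), e i.*2 <> e i.*2.+1,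
        v (e i.*2.+1) = v (e i.*2.+2) & e i.*2.+1 <> e i.*2.+2]) ->
  e l.*2 <> e 0.

Local Notation vertex := (V1 + V2)%type.

Definition isl (x : vertex) := if x is inl _ then true else false.

Definition inc (e : E) (x : vertex) :=
  match x with inl a => u e == a | inr b => v e == b end.

Definition badj (x y : vertex) :=
  (isl x != isl y) && [exists e, inc e x && inc e y].

Definition opp_end (e : E) (x : vertex) : vertex :=
  if isl x then inr (v e) else inl (u e).

Lemma badj_sym : symmetric badj.
Proof.
move=> x y; rewrite /badj eq_sym; congr (_ && _).
by apply: eq_existsb => e; rewrite andbC.
Qed.

Lemma badj_irr : irreflexive badj.
Proof. by move=> x; rewrite /badj eqxx. Qed.

Lemma inc_opp e x : inc e (opp_end e x).
Proof. by rewrite /opp_end; case: ifP => _ /=. Qed.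

Lemma isl_opp e x : isl (opp_end e x) = ~~ isl x.
Proof. by rewrite /opp_end; case: (isl x). Qed.

Lemma inc_inj e x y : inc e x -> inc e y -> isl x = isl y -> x = y.
Proof. by case: x y => [a|b] [a'|b'] //= /eqP<- /eqP<-. Qed.

Lemma inc_badj e x y : inc e x -> inc e y -> x != y -> badj x y.
Proof.
move=> ex ey nxy; rewrite /badj; apply/andP; split.
  by apply: contra nxy => /eqP h; apply/eqP; exact: (inc_inj ex ey).
by apply/existsP; exists e; rewrite ex.
Qed.

Lemma badj_opp e x : inc e x -> badj x (opp_end e x).
Proof.
move=> ex; apply: (inc_badj ex (inc_opp e x)); apply/eqP => h.
by have := isl_opp e x; rewrite -h; case: (isl x).
Qed.

Lemma card_inc e : #|[pred x | inc e x]| = 2.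
Proof.
transitivity #|[set (inl (u e) : vertex); inr (v e)]|; last by rewrite cards2.
by apply: eq_card => -[a|b]; rewrite !inE ?orbF [LHS]eq_sym.
Qed.

Section Girth.
Variable g : nat.
Hypotheses (girth_g : girth_geq g) (g_gt4 : 4 < g).

Lemma edge_inj e e' x y : badj x y -> inc e x -> inc e y -> inc e' x -> inc e' y ->
  e = e'.
Proof.
move=> /andP[xy _] ex ey e'x e'y; apply/eqP; apply: contraT => /eqP nee'.
have [eu ev] : u e = u e' /\ v e = v e'.
  by case: x y xy ex ey e'x e'y => [a|b] [a'|b'] //= _ /eqP-> /eqP-> /eqP-> /eqP->.
pose s i := if odd i then e' else e.
suff : s 2 <> s 0 by [].
apply: (girth_g (l := 1)) => // [|[|//] _]; first exact: leq_trans g_gt4.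
by rewrite /s /=; split=> // /esym.
Qed.

Lemma girth_cycle (X : {set vertex}) p : cycle_in badj X p -> g <= size p.
Proof.
(* The walks of [girth_geq] begin with a shared [u]-end, so the second vertex of the cycle must be
   on the left; a rotation by one achieves this. *)
wlog [x0 hx0] : p / exists x, ~~ isl (head x p).
  move=> H pX; case: p pX => [[]//|x [[]//|y p]] pX.
  have [xl|xl] := boolP (isl x); last by apply: (H (x :: y :: p)) => //; exists x.
  rewrite -(size_rot 1); apply: H; last first.
    case: pX => cp up sp pX; split; rewrite ?rot_cycle ?rot_uniq ?size_rot //.
    by move=> z; rewrite mem_rot; exact: pX.
  exists x; rewrite rot1_cons /=.
  by case: pX => /= /andP[/andP[]]; rewrite xl; case: (isl y).
move=> [cp up sp _].
have s0 : 0 < size p by exact: ltn_trans sp.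
pose c i := nth x0 p (i %% size p).
have cadj i : badj (c i) (c i.+1).
  have := next_cycle cp (mem_nth x0 (ltn_pmod i s0)).
  by rewrite next_nth_modn ?ltn_mod // -addn1 modnDml addn1.
have c2 i : c i != c i.+2.
  rewrite /c nth_uniq ?ltn_mod // -addn2 -{1}[i]addn0 eqn_modDl.
  by rewrite mod0n modn_small.
have cs i : isl (c i) = odd i.
  elim: i => [|i IH].
    by rewrite /c mod0n nth0; apply/negbTE; case: (p) s0 hx0.
  have /andP[] := cadj i; rewrite IH /=.
  by case: (odd i); case: (isl _).
have se : size p = (size p)./2.*2.
  rewrite -[LHS]odd_double_half; suff -> : odd (size p) = false by [].
  by rewrite -cs /c modnn -[0](mod0n (size p)) -/(c 0) cs.
have [e0 _] : exists e, inc e (c 0) && inc e (c 1).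
  by have /andP[_ /existsP] := cadj 0.
pose e i := odflt e0 [pick e | inc e (c i) && inc e (c i.+1)].
have eP i : inc (e i) (c i) /\ inc (e i) (c i.+1).
  rewrite /e; case: pickP => [? /andP[]//|h].
  by have /andP[_ /existsP[e']] := cadj i; rewrite h.
rewrite leqNgt; apply/negP => gs.
have := girth_g (l := (size p)./2) (e := e); rewrite -se; apply=> //.
- by rewrite half_gt0 ltnW.
- have shared i : if odd i.+1 then u (e i) = u (e i.+1) else v (e i) = v (e i.+1).
    have [_] := eP i; have [+ _] := eP i.+1; rewrite -cs.
    by case: (c i.+1) => [a|b] /= /eqP-> /eqP->.
  have distinct i : e i <> e i.+1.
    move=> h; have [h1 _] := eP i; have [_ h2] := eP i.+1; rewrite -h in h2.
    have /eqP := c2 i; apply; apply: (inc_inj h1 h2).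
    by rewrite !cs /= negbK.
  move=> i _; have := shared i.*2; have := shared i.*2.+1.
  by rewrite /= odd_double /=; split.
- have cp' i : c (i + size p) = c i by rewrite /c modnDr.
  by rewrite /e; have := cp' 0; have := cp' 1; rewrite add1n add0n => -> ->.
Qed.

(** Edges outside [F] have to avoid the heads as well. This is possible because an edge with both
    ends among the heads joins its later end to an earlier vertex, which only the edge of [F]
    pointing to that end can do. *)
Lemma heads_exist (F : {set E}) : 4 * #|F| <= 3 * g ->
  exists hd : E -> vertex, (forall e, inc e (hd e)) /\
    forall e e', e \in F -> e != e' -> hd e != hd e'.
Proof.
move=> Fg; have [->|F0] := eqVneq F set0.
  by exists (fun e => inl (u e)); split=> [e /=|e e']; rewrite ?eqxx ?inE.
pose deg x := #|[set e in F | inc e x]|.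
pose X := [set x | 0 < deg x]; pose L := [set x in X | deg x == 1].
have XP e x : e \in F -> inc e x -> x \in X.
  by move=> eF ex; rewrite inE card_gt0; apply/set0Pn; exists e; rewrite inE eF.
(* Incidences are counted by vertex: on the left a vertex of [L] counts once and any other vertex of
   [X] twice, at most its degree. *)
have Xcard : #|X| + #|X :\: L| <= 2 * #|F|.
  have -> : 2 * #|F| = \sum_x deg x.
    transitivity (\sum_(e in F) \sum_x inc e x : nat).
      rewrite mulnC -sum_nat_const; apply: eq_bigr => e _.
      by rewrite -(card_inc e) -sum1_card big_mkcond.
    rewrite exchange_big; apply: eq_bigr => x _.
    rewrite /deg -sum1_card big_mkcond [RHS]big_mkcond; apply: eq_bigr => e _.
    by rewrite !inE; case: (e \in F); case: (inc e x).
  rewrite -!sum1_card big_mkcond [X in _ + X]big_mkcond -big_split.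
  apply: leq_sum => x _; rewrite !inE; case: (deg x) => [|[|d]] //.
have X0 : X != set0.
  have /set0Pn[e eF] := F0; apply/set0Pn; exists (inl (u e)).
  by apply: (XP e) => //=.
have leafL : {in X, forall x, #|nbrs badj X x| <= 1 -> x \in L}.
  move=> x xX xN; have d0 : 0 < deg x by move: xX; rewrite inE.
  suff d1 : deg x <= 1 by rewrite inE xX eqn_leq d1 d0.
  rewrite leqNgt; apply/negP => /card_gt1P[e [e' [eF e'F nee']]].
  move: eF e'F; rewrite !inE => /andP[eF ex] /andP[e'F e'x].
  suff h : opp_end e x = opp_end e' x.
    have e'y : inc e' (opp_end e x) by rewrite h inc_opp.
    by rewrite (edge_inj (badj_opp ex) ex (inc_opp e x) e'x e'y) eqxx in nee'.
  by apply: (card_le1_eqP xN); rewrite inE badj_opp ?(XP _ _ _ (inc_opp _ _)).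
(* Removing a leaf [y] of [F] that meets every cycle spanned by [F] leaves a
   forest; its edges point away from the other end [z] of the edge [f] at [y],
   and [f] itself points to [z]. *)
have [||y yL aX] := feedback_vertex badj_sym badj_irr _ X0 g_gt4 leafL Xcard Fg.
- by apply/subsetP => x; rewrite inE => /andP[].
- by move=> p; exact: girth_cycle.
have /andP[yX /cards1P[f ef]] : (y \in X) && (deg y == 1) by move: yL; rewrite inE.
have /andP[fF fy] : (f \in F) && inc f y.
  by have := set11 f; rewrite -ef inE.
have fu e : e \in F -> inc e y -> e = f.
  by move=> eF ey; apply/set1P; rewrite -ef inE eF.
pose z := opp_end f y.
have zX : z \in X :\ y.
  rewrite in_setD1 (XP f) ?inc_opp // andbT; apply/eqP => h.
  by have := isl_opp f y; rewrite -/z h; case: (isl y).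
have [r [rinj rz r1]] := elimination_order badj_sym badj_irr zX aX.
pose hdF e := if e == f then z else
  if r (inl (u e)) < r (inr (v e)) then inr (v e) else inl (u e).
have hdFP e : e \in F -> inc e (hdF e) /\ hdF e \in X :\ y.
  move=> eF; rewrite /hdF; case: (eqVneq e f) => [->|nef].
    by rewrite zX inc_opp.
  have ny x : inc e x -> x \in X :\ y.
    move=> ex; rewrite in_setD1 (XP e) // andbT; apply: contra nef => /eqP xy.
    by rewrite (fu e) // -xy.
  by case: ifP => _; split; rewrite ?ny /=.
have hdF_opp e : e \in F -> e != f ->
    opp_end e (hdF e) \in X :\ y /\ r (opp_end e (hdF e)) < r (hdF e).
  move=> eF nef.
  have ny x : inc e x -> x \in X :\ y.
    move=> ex; rewrite in_setD1 (XP e) // andbT; apply: contra nef => /eqP xy.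
    by rewrite (fu e) // -xy.
  split; first by apply: ny; exact: inc_opp.
  rewrite /hdF (negPf nef).
  case: (ltnP (r (inl (u e))) (r (inr (v e)))) => h; rewrite /opp_end //=.
  rewrite ltn_neqAle h andbT; apply/eqP => /rinj.
  by move=> /(_ (ny _ _) (ny _ _)) H; have := H (eqxx _) (eqxx _).
(* otherwise the head of [e] would have two earlier neighbours *)
have lower e x e' w : e \in F -> hdF e = x -> inc e' x -> w = opp_end e' x ->
    w \in X :\ y -> r w < r x -> e = e'.
  move=> eF ex e'x ew wX wx.
  have [_] := hdFP e eF; rewrite ex => xX.
  have [ef'|nef] := eqVneq e f.
    by have := rz _ wX; move: wx; rewrite -ex /hdF ef' eqxx ltnNge => /negbTE->.
  have [oX ox] := hdF_opp e eF nef; rewrite ex in oX ox.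
  have ie : inc e x by have [] := hdFP e eF; rewrite ex.
  have h : opp_end e x = w.
    by apply: (r1 x) => //; [exact: badj_opp|rewrite ew; exact: badj_opp].
  apply: (edge_inj (badj_opp ie)) => //; first exact: inc_opp.
  by rewrite h ew inc_opp.
pose Hd := [set x | [exists e in F, hdF e == x]].
have HdP e : e \in F -> hdF e \in Hd.
  by move=> eF; rewrite inE; apply/exists_inP; exists e.
(* Outside [F] the right end is taken only if the left one is already a head, so a conflict means
   that both ends are heads. *)
pose hd e := if e \in F then hdF e else
  if inl (u e) \in Hd then inr (v e) else inl (u e).
exists hd; split.
  move=> e; rewrite /hd; case: ifP => [/hdFP[]//|_].
  by case: ifP => _ /=.
move=> e e' eF nee'; rewrite /hd eF; case: ifP => [e'F|e'F]; apply/eqP => h.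
  (* The two edges are not both [f]. One other than [f] has its tail before the common head, and
     [lower] then identifies the two. *)
  wlog nef' : e e' eF e'F nee' h / e' != f.
    move=> H; have [e'f|] := eqVneq e' f; last exact: (H e e').
    by apply: (H e' e) => //; [rewrite eq_sym|rewrite -e'f].
  have [oX ox] := hdF_opp e' e'F nef'.
  have := lower e _ e' _ eF h _ erefl oX ox.
  by case: (hdFP e' e'F) => -> _ /(_ isT) /eqP; rewrite (negPf nee').
have both x : inc e' x -> x \in Hd.
  have h' : hd e' \in Hd by rewrite /hd e'F -h HdP.
  move: h'; rewrite /hd e'F; case: ifP => [h1 h2|->//].
  by case: x => [a|b] /= /eqP<-.
have HdX x : x \in Hd -> x \in X :\ y.
  by rewrite inE => /exists_inP[e1 /hdFP[_ h1] /eqP<-].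
have incU : inc e' (inl (u e')) by rewrite /=.
have incV : inc e' (inr (v e')) by rewrite /=.
have final x w : inc e' x -> inc e' w -> w = opp_end e' x -> r w < r x -> False.
  move=> ix iw ew wx; have := both _ ix; rewrite inE => /exists_inP[e1 e1F /eqP e1x].
  have := lower e1 x e' w e1F e1x ix ew (HdX _ (both _ iw)) wx.
  by move=> e1e; rewrite -e1e e1F in e'F.
case: (ltngtP (r (inl (u e'))) (r (inr (v e')))) => [h1|h1|h1].
- exact: (final _ _ incV incU erefl h1).
- exact: (final _ _ incU incV erefl h1).
- by have := rinj _ _ (HdX _ (both _ incU)) (HdX _ (both _ incV)) h1.
Qed.

End Girth.
End BipartiteGraph.

(** * The storage scheme of a graph *)

(** The space is one orientation bit per edge and [d] cells per vertex. The head of an edge carrying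
    a stored element is the head of no other edge, so a marked cell that is read can only come from
    the queried element itself. *)
Lemma graph_scheme (E V1 V2 : finType) (u : E -> V1) (v : E -> V2) (g n m d : nat) :
  girth_geq u v g -> 4 < g -> 4 * n <= 3 * g -> m <= #|E| * d ->
  has_scheme m n 2 (#|E| + (#|V1| + #|V2|) * d).
Proof.
move=> girth_g g4 ng mEd.
pose I := (E + (V1 + V2) * 'I_d)%type.
have cI : #|{: I}| = #|E| + (#|V1| + #|V2|) * d.
  by rewrite card_sum card_prod card_sum card_ord.
rewrite -cI; pose s := #|{: I}|.
have mU : m <= #|{: E * 'I_d}| by rewrite card_prod card_ord.
pose elt (x : 'I_m) : E * 'I_d := enum_val (widen_ord mU x).
have elt_inj : injective elt.
  by move=> x y /enum_val_inj /(congr1 val) /= h; apply: val_inj.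
pose active (S : {set 'I_m}) := [set (elt x).1 | x in S].
have head_ex (S : {S : {set 'I_m} | #|S| <= n}) :
    exists hd : {ffun E -> V1 + V2}, [forall e, inc u v e (hd e)] &&
      [forall e in active (val S), forall e', (e != e') ==> (hd e != hd e')].
  have aS : 4 * #|active (val S)| <= 3 * g.
    rewrite (leq_trans _ ng) // leq_mul2l /=.
    exact: leq_trans (leq_imset_card _ _) (valP S).
  have [hd [h1 h2]] := heads_exist girth_g g4 aS.
  exists [ffun e => hd e]; apply/andP; split.
    by apply/forallP => e; rewrite ffunE.
  apply/forall_inP => e eS; apply/forallP => e'; rewrite !ffunE.
  by apply/implyP; exact: h2.
pose hd S := xchoose (head_ex S).
pose bit S (k : I) := match k with
  | inl e => ~~ isl (hd S e)
  | inr (w, j) => [exists x in val S, (hd S (elt x).1 == w) && ((elt x).2 == j)]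
  end.
pose st S : s.-tuple bool := [tuple bit S (enum_val k) | k < s].
have stE S k : tnth (st S) (enum_rank k) = bit S k.
  by rewrite tnth_mktuple enum_rankK.
pose cell (w : V1 + V2) j : dtree s :=
  Probe (enum_rank (inr (w, j) : I)) (Answer s false) (Answer s true).
pose qu x := Probe (enum_rank (inl (elt x).1 : I))
  (cell (inl (u (elt x).1)) (elt x).2) (cell (inr (v (elt x).1)) (elt x).2).
constructor; apply: (@Scheme m n 2 s st qu) => // S x.
have /andP[/forallP hd1 /forall_inP hd2] := xchooseP (head_ex S).
have -> : run (qu x) (st S) = bit S (inr (hd S (elt x).1, (elt x).2)).
  rewrite /qu /= !stE.
  have : inc u v (elt x).1 (hd S (elt x).1) by exact: hd1.
  by rewrite /bit; case: (hd S (elt x).1) => [a|b] /= /eqP->;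
    case: [exists x0 in _, _].
apply/exists_inP/idP => [[y yS /andP[/eqP h /eqP e2]]|xS]; last by exists x; rewrite ?eqxx.
suff <- : y = x by [].
apply: elt_inj; apply/eqP; rewrite -pair_eqE /pair_eq /= e2 eqxx andbT.
apply: contraT => e1.
have yA : (elt y).1 \in active (val S) by apply: imset_f.
by have /forallP /(_ (elt x).1) := hd2 _ yA; rewrite e1 -/(hd S) h eqxx.
Qed.

Lemma sA_graph (E V1 V2 : finType) (u : E -> V1) (v : E -> V2) (g n m d : nat) :
  girth_geq u v g -> 4 < g -> 4 * n <= 3 * g -> m <= #|E| * d ->
  sA m n 2 <= #|E| + (#|V1| + #|V2|) * d.
Proof.
move=> h1 h2 h3 h4; have [_] := @sAP m n 2 isT; apply.
exact: graph_scheme h1 h2 h3 h4.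
Qed.

(** * Coset graphs of unipotent groups *)

Section CosetGraph.
Variables (gT : finGroupType) (G : {group gT}).

(** The edges are the elements of [G], each joining its left cosets of two subgroups. Edges with a
    common end differ by a right factor in the subgroup, so a closed walk is an alternating
    relation. *)
Definition coset_edge := {x : gT | x \in G}.
Definition coset_vertex (L : {group gT}) := {A : {set gT} | A \in lcosets L G}.

Lemma lcoset_in (L : {group gT}) (x : coset_edge) : (val x *: L)%g \in lcosets L G.
Proof. by apply/lcosetsP; exists (val x) => //; exact: valP. Qed.

Definition coset_end (L : {group gT}) (x : coset_edge) : coset_vertex L :=
  exist (fun A : {set gT} => A \in lcosets L G) _ (lcoset_in L x).

Lemma coset_endP (L : {group gT}) x y :
  coset_end L x = coset_end L y -> ((val x)^-1 * val y)%g \in L.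
Proof.
move=> /(congr1 val) /= h; rewrite -mem_lcoset.
by rewrite h lcoset_refl.
Qed.

Lemma card_coset_edge : #|{: coset_edge}| = #|G|.
Proof. by rewrite card_sig. Qed.

Lemma card_coset_vertex (L : {group gT}) : L \subset G ->
  #|{: coset_vertex L}| * #|L| = #|G|.
Proof. by move=> sLG; rewrite card_sig card_lcosets mulnC Lagrange. Qed.

End CosetGraph.

Section Unipotent.
Local Open Scope ring_scope.
Variables (F : finFieldType) (n : nat).
Hypothesis n_gt1 : (1 < n)%N.

Definition Xmx (b : bool) (a : F) : 'M[F]_n.+1 :=
  \matrix_(i, j) ((i == j)%:R + a *+ ((j == i.+1 :> nat) && (odd i == b))).

Definition ord_prev (j : 'I_n.+1) : 'I_n.+1 := inord j.-1.

Lemma mul_Xmx (M : 'M[F]_n.+1) b a i j :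
  (M *m Xmx b a) i j =
  M i j + (M i (ord_prev j) * a) *+ ((0 < j)%N && (odd j != b)).
Proof.
rewrite mxE; under eq_bigr => k _ do rewrite mxE mulrDr.
rewrite big_split /=; congr (_ + _).
  rewrite (bigD1 j) //= eqxx mulr1 big1 ?addr0 // => k /negPf->.
  by rewrite mulr0.
have vp : (0 < j)%N -> ord_prev j = j.-1 :> nat.
  by move=> j0; rewrite inordK // (leq_ltn_trans (leq_pred j)).
have [j0|j0] := posnP j.
  by rewrite j0 /= mulr0n big1 // => k _; rewrite mulr0.
rewrite (bigD1 (ord_prev j)) //= vp // prednK // eqxx /=.
have -> : (odd j.-1 == b) = (odd j != b).
  by rewrite -{2}(prednK j0) /=; case: (odd _); case: b.
rewrite big1 ?addr0 ?mulrnAr // => k kj.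
rewrite (_ : (j == k.+1 :> nat) = false) ?mulr0 //.
by apply: contraNF kj => /eqP jk; apply/eqP/val_inj; rewrite /= vp // jk.
Qed.

Lemma Xmx0 b : Xmx b 0 = 1%:M.
Proof. by apply/matrixP => i j; rewrite !mxE mul0rn addr0. Qed.

(** The nilpotent parts multiply to zero: an entry above the diagonal in a row of parity [b] ends in
    a column of the other parity, and the row of that index has no such entry. *)
Lemma XmxD b a a' : Xmx b a *m Xmx b a' = Xmx b (a + a').
Proof.
apply/matrixP => i j; rewrite mul_Xmx !mxE -addrA; congr (_ + _).
have vp : (0 < j)%N -> ord_prev j = j.-1 :> nat.
  by move=> j0; rewrite inordK // (leq_ltn_trans (leq_pred j)).
have [j0|j0] := posnP j.
  by rewrite j0 /= !mulr0n addr0.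
have -> : (i == ord_prev j) = (j == i.+1 :> nat).
  by rewrite -val_eqE /= vp // eq_sym -(eqn_add2r 1) !addn1 prednK.
rewrite andTb vp // mulrnDl; congr (_ + _).
have [ji|ji] := eqVneq (j : nat) i.+1; last first.
  rewrite add0r andFb mulr0n; have [h|] := boolP ((_ == _) && _).
    have -> : (odd j != b) = false; last by rewrite mulr0n.
    by case/andP: h => /eqP h /eqP <-; rewrite -(prednK j0) h /= negbK eqxx.
  by rewrite mulr0n mul0r mul0rn.
rewrite ji /= eqn_leq ltnn andbF andFb mulr0n addr0 mul1r.
by rewrite (_ : (~~ odd i != b) = (odd i == b)) //; case: (odd i); case: b.
Qed.

Lemma Xmx_unit b a : Xmx b a \is a GRing.unit.
Proof.
have : Xmx b a *m Xmx b (- a) = 1%:M by rewrite XmxD subrr Xmx0.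
by move/mulmx1_unit => [].
Qed.

Definition Xgl b a : {'GL_n.+1[F]} := insubd (1%g : {'GL_n.+1[F]}) (Xmx b a).

Lemma val_Xgl b a : GLval (Xgl b a) = Xmx b a.
Proof. by apply: insubdK; exact: Xmx_unit. Qed.

Lemma GLval_inj : injective (@GLval n.+1 F).
Proof. exact: val_inj. Qed.

Lemma XglD b a a' : (Xgl b a * Xgl b a')%g = Xgl b (a + a').
Proof. by apply: GLval_inj; rewrite GL_MxE !val_Xgl XmxD. Qed.

Lemma Xgl0 b : Xgl b 0 = 1%g.
Proof. by apply: GLval_inj; rewrite val_Xgl Xmx0 GL_1E. Qed.

Lemma Xgl_inj b : injective (Xgl b).
Proof.
move=> a a' /(congr1 (@GLval n.+1 F)); rewrite !val_Xgl.
pose i : 'I_n.+1 := inord b; pose j : 'I_n.+1 := inord b.+1.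
have b2 : (b.+1 < n.+1)%N by case: (b); lia.
have vi : i = b :> nat by rewrite inordK // ltnW.
have vj : j = b.+1 :> nat by rewrite inordK.
move/matrixP => /(_ i j); rewrite !mxE vi vj eqxx oddb eqxx /=.
by rewrite !mulr1n => /addrI.
Qed.

Definition root_set b : {set {'GL_n.+1[F]}} := [set Xgl b a | a : F].

Lemma root_group_set b : group_set (root_set b).
Proof.
apply/group_setP; split; first by apply/imsetP; exists 0; rewrite ?Xgl0.
move=> _ _ /imsetP[a _ ->] /imsetP[a' _ ->]; rewrite XglD; exact: imset_f.
Qed.

Definition root_group b := Group (root_group_set b).

Lemma card_root_group b : #|root_group b| = #|F|.
Proof. by rewrite card_imset //; exact: Xgl_inj. Qed.

Definition unipotent := (root_group false <*> root_group true)%G.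

Lemma root_sub b : root_group b \subset unipotent.
Proof. by case: b; rewrite ?joing_subl ?joing_subr. Qed.

Lemma unipotent_girth : girth_geq (coset_end (G := unipotent) (root_group false))
  (coset_end (G := unipotent) (root_group true)) n.+1.*2.
Proof.
move=> l e l0 ln he e_closed.
have step (b : bool) (x y : coset_edge unipotent) :
    coset_end (root_group b) x = coset_end (root_group b) y -> x <> y ->
    exists2 a, a != 0 & val y = (val x * Xgl b a)%g.
  move=> /coset_endP /imsetP[a _ h] nxy; exists a; last by rewrite -h mulKVg.
  apply/eqP => a0; apply: nxy; apply: val_inj; apply/eqP.
  by rewrite eq_mulVg1 h a0 Xgl0.
pose M i := GLval ((val (e 0))^-1 * val (e i))%g.
have M0 : M 0 = 1%:M by rewrite /M mulVg GL_1E.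
have stepM i : (i < l.*2)%N -> exists2 a, a != 0 &
    M i.+1 = M i *m Xmx (odd i) a /\ M i = M i.+1 *m Xmx (odd i) (- a).
  move=> il.
  have [a a0 h] : exists2 a, a != 0 & val (e i.+1) = (val (e i) * Xgl (odd i) a)%g.
    have i2 : (i./2 < l)%N.
      by rewrite -ltn_double (leq_ltn_trans _ il) // -{2}(odd_double_half i) leq_addl.
    have [h1 h2 h3 h4] := he _ i2.
    have := odd_double_half i; case: (odd i) => /= hi.
      by apply: step; rewrite -hi add1n.
    by apply: step; rewrite -hi add0n.
  exists a => //.
  have hM : M i.+1 = M i *m Xmx (odd i) a by rewrite /M h mulgA GL_MxE val_Xgl.
  by split=> //; rewrite hM -(mulmxA (M i)) XmxD subrr Xmx0 mulmx1.
have vp (j : 'I_n.+1) : (0 < j)%N -> ord_prev j = j.-1 :> nat.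
  by move=> j0; rewrite inordK // (leq_ltn_trans (leq_pred j)).
have fwd i : (i <= l)%N -> (forall j : 'I_n.+1, (i < j)%N -> M i 0 j = 0) /\
    (forall j : 'I_n.+1, i = j :> nat -> M i 0 j != 0).
  elim: i => [_|i IH il].
    rewrite M0; split=> j; rewrite mxE.
      by move=> j0; rewrite (_ : (0 == j) = false) //; apply/eqP => h; rewrite -h in j0.
    by move=> h; rewrite (_ : (0 == j) = true) ?oner_eq0 //; apply/eqP/val_inj.
  have [IH1 IH2] := IH (ltnW il).
  have [a a0 [h _]] := stepM i (leq_trans il (leq_trans (leq_addr _ _) (eq_leq (addnn l)))).
  rewrite h; split=> j ij; rewrite mul_Xmx.
    rewrite !IH1 ?mul0r ?mul0rn ?addr0 //; last by rewrite ltnW.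
    by rewrite vp; lia.
  rewrite IH1 ?add0r -?ij // (_ : _ && _); last by rewrite /=; case: (odd i).
  by rewrite mulr1n mulf_neq0 // IH2 // vp -ij.
(* The first backward factor has type [true] and leaves the row [(1, 0, ..., 0)] unchanged, so the
   backward row lags one column behind the forward one. *)
have bwd i : (i <= l)%N -> forall j : 'I_n.+1, (0 < j)%N -> (i <= j)%N ->
    M (l.*2 - i)%N 0 j = 0.
  elim: i => [_ j j0 _|i IH il j j0 ij].
    rewrite subn0 /M e_closed -/(M 0) M0 mxE.
    by rewrite (_ : (0 == j) = false) //; apply/eqP => h; rewrite -h in j0.
  have k_lt : (l.*2 - i.+1 < l.*2)%N by lia.
  have [a _ [_ ->]] := stepM _ k_lt.
  have -> : (l.*2 - i.+1).+1 = (l.*2 - i)%N by lia.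
  rewrite mul_Xmx IH ?add0r //; [|lia|lia].
  have -> : odd (l.*2 - i.+1) = ~~ odd i by rewrite oddB ?odd_double //=; lia.
  have [h|] := boolP (_ && _); last by rewrite mulr0n.
  have /andP[p0 ip] : (0 < ord_prev j)%N && (i <= ord_prev j)%N.
    rewrite vp //; have [i0|i0] := posnP i; last lia.
    by move: h j0; rewrite i0 /=; case: (j : nat) => [|[|]].
  by rewrite (IH (ltnW il) _ p0 ip) mul0r mul0rn.
have ll : (l < n.+1)%N by rewrite -ltn_double.
have [_ h1] := fwd l (leqnn l).
have := h1 (Ordinal ll) erefl.
have /= := bwd l (leqnn l) (Ordinal ll) l0 (leqnn l).
by rewrite -addnn addnK => ->; rewrite eqxx.
Qed.

(* The matrices of the group are truncated block Toeplitz matrices: their 2 x 2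
   blocks are the coefficients of a matrix of determinant 1 over [{poly F}]. *)
Definition toeplitz (M : 'M[F]_n.+1) (P : bool -> bool -> {poly F}) :=
  forall i j, M i j = (P (odd i) (odd j))`_(j./2 - i./2) *+ (i./2 <= j./2)%N.

Definition unimodular (P : bool -> bool -> {poly F}) :=
  [/\ P false false * P true true - P false true * P true false = 1,
      (P false false)`_0 = 1 & (P true false)`_0 = 0].

(** Right multiplication is a column operation on the 2 x 2 polynomial matrix. Type [false] adds a
    multiple of the first column to the second; type [true] adds a multiple of ['X] times the second
    to the first, since its entries cross into the next block. *)
Lemma toeplitz_step M P b a : toeplitz M P -> unimodular P ->
  exists P', toeplitz (M *m Xmx b a) P' /\ unimodular P'.
Proof.
move=> MP [dP P00 P10].
pose s : {poly F} := if b then 'X else 1.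
have vp (j : 'I_n.+1) : (0 < j)%N -> ord_prev j = j.-1 :> nat.
  by move=> j0; rewrite inordK // (leq_ltn_trans (leq_pred j)).
pose P' c d := P c d + (a *: (s * P c (~~ d))) *+ (d != b).
exists P'; split.
  move=> i j; rewrite mul_Xmx !MP /P' coefD mulrnDl; congr (_ + _).
  have [->|j0] := posnP j.
    case: b @s {P'} => s; rewrite /= ?mulr0n ?coef0 ?mul0rn //.
    by rewrite sub0n coefZ coefXM eqxx mulr0 mul0rn.
  rewrite vp // andTb; have [jb|jb] := eqVneq (odd j) b; first by rewrite !mulr0n coef0 mul0rn.
  rewrite !mulr1n coefZ.
  have oj : odd j.-1 = ~~ odd j by rewrite -{2}(prednK j0) /= negbK.
  rewrite oj /s; move: jb; case: b {P' s} => jb.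
    have {}jb : odd j = false by case: (odd j) jb.
    have j2 : j./2 = (j.-1)./2.+1.
      have := odd_double_half j; have := odd_double_half j.-1.
      by rewrite oj jb /=; lia.
    rewrite coefXM j2; have [ij|ij] := leqP i./2 (j.-1)./2.
      by rewrite subSn // /= leqW // !mulr1n mulrC.
    have -> : ((j.-1)./2.+1 - i./2 = 0)%N by lia.
    by rewrite mulr0n mul0r eqxx mulr0 mul0rn.
  have {}jb : odd j = true by case: (odd j) jb.
  have j2 : j./2 = (j.-1)./2.
    have := odd_double_half j; have := odd_double_half j.-1.
    by rewrite oj jb /=; lia.
  by rewrite mul1r j2 mulrnAl mulrC.
rewrite /unimodular /P' /s; case: b {P' s} => /=; rewrite ?mulr0n ?mulr1n ?addr0.
  split; last 2 first.
  - by rewrite coefD coefZ coefXM eqxx mulr0 addr0.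
  - by rewrite coefD coefZ coefXM eqxx mulr0 addr0.
  by rewrite -dP -!mul_polyC; ring.
by split=> //; rewrite -dP -!mul_polyC; ring.
Qed.

Lemma unipotent_toeplitz x : x \in unipotent ->
  exists P, toeplitz (GLval x) P /\ unimodular P.
Proof.
case/gen_prodgP => k [c cA ->]; elim: k c cA => [|k IH] c cA.
  rewrite big_ord0 GL_1E; exists (fun b b' => (b == b')%:R%:P); split; last first.
    by split; rewrite /= ?coefC ?mulr1 ?mulr0 ?subr0 ?mul0r.
  move=> i j; rewrite mxE coefC subn_eq0.
  have -> : (i == j) = (odd i == odd j) && (j./2 == i./2).
    by rewrite -val_eqE /= -{1}(odd_double_half i) -{1}(odd_double_half j); lia.
  by rewrite eqn_leq; case: (odd i == odd j); case: (j./2 <= i./2)%N; rewrite /= ?mul0rn ?mulr0n.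
have step (z : {'GL_n.+1[F]}) b a :
    (exists P, toeplitz (GLval z) P /\ unimodular P) ->
    exists P, toeplitz (GLval (z * Xgl b a)%g) P /\ unimodular P.
  by case=> P [h1 h2]; rewrite GL_MxE val_Xgl; exact: toeplitz_step h1 h2.
rewrite big_ord_recr.
have [b [a ->]] : exists b a, c ord_max = Xgl b a.
  by have := cA ord_max; rewrite inE => /orP[] /imsetP[a _ ->]; [exists false, a|exists true, a].
by apply: step; apply: IH => i; exact: cA.
Qed.

(** In degree [k] the determinant identity is linear in the coefficient [k] of [P true true], with
    factor 1 from the constant coefficient of [P false false]; lower coefficients are known by
    induction. *)
Lemma unimodular_coef P P' k : unimodular P -> unimodular P' ->
  (forall l b, (l <= k)%N -> (P false b)`_l = (P' false b)`_l) ->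
  (forall l, (l <= k)%N -> (P true false)`_l = (P' true false)`_l) ->
  (P true true)`_k = (P' true true)`_k.
Proof.
move=> [dP a0 _] [dP' a0' _].
elim/ltn_ind: k => k IH h0 h1.
have := congr1 (fun p : {poly F} => p`_k) (etrans dP (esym dP')).
rewrite /= !coefB !coefM.
have -> : \sum_(i < k.+1) (P false true)`_i * (P true false)`_(k - i) =
    \sum_(i < k.+1) (P' false true)`_i * (P' true false)`_(k - i).
  apply: eq_bigr => i _; rewrite h1 ?leq_subr // h0 //.
  by rewrite -ltnS ltn_ord.
move/addIr; rewrite !big_ord_recl /= !subn0 a0 a0' !mul1r.
suff -> : \sum_(i < k) (P false false)`_(bump 0 i) * (P true true)`_(k - bump 0 i) =
    \sum_(i < k) (P' false false)`_(bump 0 i) * (P' true true)`_(k - bump 0 i).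
  by move/addIr.
apply: eq_bigr => i _; have ik := ltn_ord i; rewrite /bump /= add1n.
rewrite h0 //; congr (_ * _).
by apply: IH => [|l b lk|l lk]; [lia|apply: h0; lia|apply: h1; lia].
Qed.

(** Row 0 and the even columns of row 1, whose entries in column 0 are fixed, give the coefficients
    of three of the four polynomials; [unimodular_coef] supplies the fourth. *)
Lemma card_unipotent : (#|unipotent| <= #|F| ^ (n + n./2))%N.
Proof.
pose code (x : {'GL_n.+1[F]}) : {ffun 'I_n -> F} * {ffun 'I_(n./2) -> F} :=
  ([ffun j : 'I_n => GLval x 0 (inord j.+1)],
   [ffun j : 'I_(n./2) => GLval x (inord 1) (inord j.+1.*2)]).
suff code_inj : {in unipotent &, injective code}.
  rewrite -(card_in_imset code_inj) (leq_trans (max_card _)) //.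
  by rewrite card_prod !card_ffun !card_ord expnD.
move=> x y xU yU [/ffunP c0 /ffunP c1].
have [P [xP uP]] := unipotent_toeplitz xU.
have [P' [yP uP']] := unipotent_toeplitz yU.
have row0 l (b : bool) : (l.*2 + b <= n)%N -> (P false b)`_l = (P' false b)`_l.
  move=> lb; pose j : 'I_n.+1 := inord (l.*2 + b).
  have vj : j = (l.*2 + b)%N :> nat by rewrite inordK.
  have oj : odd j = b by rewrite vj oddD odd_double oddb.
  have hj : j./2 = l by rewrite vj halfD odd_double /= doubleK; case: (b); rewrite addn0.
  have : GLval x 0 j = GLval y 0 j.
    have [j0|j0] := posnP j.
      rewrite xP yP /= oj hj; have -> : l = 0 by rewrite -hj j0.
      have -> : b = false by rewrite -oj j0.
      by case: uP uP' => _ -> _ [_ -> _].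
    have jn : (j.-1 < n)%N by rewrite prednK // -ltnS ltn_ord.
    have := c0 (Ordinal jn); rewrite !ffunE /= prednK //.
    by rewrite inord_val.
  by rewrite xP yP /= oj hj subn0 !mulr1n.
have v1 : (inord 1 : 'I_n.+1) = 1 :> nat by rewrite inordK // ltnS ltnW.
have row1 l : (l.*2 <= n)%N -> (P true false)`_l = (P' true false)`_l.
  case: l => [_|l ln]; first by case: uP uP' => _ _ -> [_ _ ->].
  have ln2 : (l < n./2)%N by rewrite -(doubleK l.+1) half_leq.
  have := c1 (Ordinal ln2); rewrite !ffunE xP yP /= !inordK; try lia.
  by rewrite /= odd_double doubleK /= !mulr1n.
have all_coef (b b' : bool) k : (k.*2 + b' <= n)%N -> (P b b')`_k = (P' b b')`_k.
  case: b b' => [] [] kn; rewrite ?row0 ?row1 //; last by move: kn; rewrite addn0.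
  apply: unimodular_coef => //.
    by move=> l b lk; apply: row0; move: kn; case: b => /=; lia.
  by move=> l lk; apply: row1; move: kn => /=; lia.
apply: GLval_inj; apply/matrixP => i j; rewrite xP yP.
have [ij|ij] := leqP i./2 j./2; last by rewrite !mulr0n.
rewrite all_coef //; have := odd_double_half j; have := ltn_ord j; lia.
Qed.

End Unipotent.

(** * The hexagon graph *)

Section HexagonRelations.
Local Open Scope ring_scope.
Variables (F : fieldType) (a b : nat -> F).

(* Along a walk whose points have first coordinates [a i] and whose slopes
   increase by [b i], the first four line coordinates change by moments and the
   fifth one by [area], up to moments (lemma [hexagon_girth]). *)
Definition moment j l := \sum_(0 <= i < l) b i * a i ^+ j.

Definition area l :=
  \sum_(0 <= i < l) b i * a i *
    (a i ^+ 2 * moment 0 i - a i * moment 1 i *+ 2 + moment 2 i).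

(** The vanishing moments annihilate all polynomials of degree at most 3. The one with root list [c]
    would leave a single nonzero term if exactly one index had [a i] outside [c]. *)
Lemma moment_annihilator l (c : seq F) : (size c <= 3)%N ->
  (forall i, (i < l)%N -> b i != 0) -> (forall j, (j < 4)%N -> moment j l = 0) ->
  count (fun i => a i \notin c) (iota 0 l) <> 1%N.
Proof.
move=> c3 b0 m0 c1; pose p := \prod_(y <- c) ('X - y%:P).
have sp : (size p <= 4)%N by rewrite size_prod_XsubC.
have p_sum : \sum_(i <- iota 0 l) b i * p.[a i] = 0.
  have -> : iota 0 l = index_iota 0 l by rewrite /index_iota subn0.
  under eq_bigr => i _ do rewrite (horner_coef_wide _ sp) mulr_sumr.
  rewrite exchange_big big1 //= => j _.
  under eq_bigr => i _ do rewrite mulrCA.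
  by rewrite -mulr_sumr -/(moment j l) m0 ?mulr0.
have pE i : (p.[a i] == 0) = (a i \in c) by rewrite -rootE root_prod_XsubC.
have [i0 ei0] : exists i0, [seq i <- iota 0 l | a i \notin c] = [:: i0].
  by move: c1; rewrite -size_filter; case: filter => [|i0 [|]] // _; exists i0.
have : i0 \in [seq i <- iota 0 l | a i \notin c] by rewrite ei0 mem_head.
rewrite mem_filter mem_iota add0n => /and3P[ai0 _ il].
have : b i0 * p.[a i0] != 0 by rewrite mulf_neq0 ?b0 ?pE.
suff -> : b i0 * p.[a i0] = 0 by rewrite eqxx.
rewrite -[RHS]p_sum (bigID (fun i => a i \notin c)) /= [X in _ + X]big1 ?addr0.
  by rewrite -big_filter ei0 big_seq1.
by move=> i; rewrite negbK -pE => /eqP->; rewrite mulr0.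
Qed.

(** If [x0 = x2], discarding at most three values leaves exactly one entry; which one depends on
    whether [x1] equals [x3] or [x4]. *)
Lemma pentagon_chord (x0 x1 x2 x3 x4 : F) :
  (forall c, (size c <= 3)%N ->
    count (fun y => y \notin c) [:: x0; x1; x2; x3; x4] <> 1%N) ->
  x0 != x1 -> x1 != x2 -> x2 != x3 -> x3 != x4 -> x4 != x0 -> x0 != x2.
Proof.
move=> H n01 n12 n23 n34 n40; apply/eqP => e; rewrite -e in n12 n23.
have [e13|n13] := eqVneq x1 x3.
  rewrite -e13 in n34; apply: (H [:: x0; x1]) => //=.
  by rewrite -e -e13 !inE !eqxx !orbT /= (negPf n40) eq_sym (negPf n34).
have [e14|n14] := eqVneq x1 x4.
  rewrite -e14 in n34; apply: (H [:: x0; x1]) => //=.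
  by rewrite -e -e14 !inE !eqxx !orbT /= eq_sym (negPf n23) (negPf n34).
apply: (H [:: x0; x3; x4]) => //=; rewrite -e !inE !eqxx !orbT /=.
by rewrite eq_sym (negPf n01) (negPf n13) (negPf n14).
Qed.

Lemma hexagon_relation l : (0 < l < 6)%N -> (forall i, (i < l)%N -> b i != 0) ->
  (forall i, (i.+1 < l)%N -> a i != a i.+1) -> a l.-1 != a 0%N ->
  (forall j, (j < 4)%N -> moment j l = 0) -> area l <> 0.
Proof.
move=> l6 b0 an al m0 area0; have cnt := moment_annihilator _ b0 m0.
case: l l6 b0 an al m0 cnt area0 => [|[|[|[|[|[|]]]]]] //= _ b0 an al m0 cnt.
- by rewrite eqxx in al.
- move=> _; apply: (cnt [:: a 0%N]) => //=.
  by rewrite !inE eqxx (negPf al).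
- move=> _; apply: (cnt [:: a 1%N; a 2%N]) => //=; have n01 := an 0%N isT.
  by rewrite !inE !eqxx !orbT (negPf n01) eq_sym (negPf al).
- have := an 0%N isT; have := an 1%N isT; have := an 2%N isT => n23 n12 n01.
  (* For [l = 4] isolating one index forces the [a i] to alternate between two values. The moments
     then give [b 2 = - b 0] and [b 3 = - b 1], and the area is [b 0 * b 1 * (a 1 - a 0) ^+ 3]. *)
  have e02 : a 0%N = a 2%N.
    apply/eqP; apply: contraT => n02; case: (cnt [:: a 1%N; a 2%N; a 3%N]) => //=.
    by rewrite !inE !eqxx !orbT (negPf n01) (negPf n02) eq_sym (negPf al).
  have e13 : a 1%N = a 3%N.
    apply/eqP; apply: contraT => n13; case: (cnt [:: a 0%N; a 2%N; a 3%N]) => //=.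
    by rewrite !inE !eqxx !orbT (eq_sym (a 1%N)) (negPf n01) (negPf n12) (negPf n13).
  have := m0 0%N isT; have := m0 1%N isT.
  rewrite /area /moment /index_iota /= !big_cons !big_nil -e02 -e13 !expr0 !expr1.
  move=> h1 h0.
  have b2 : b 2%N = - b 0%N.
    apply/eqP; rewrite -addr_eq0.
    have : (b 2%N + b 0%N) * (a 0%N - a 1%N) == 0.
      have -> : (b 2%N + b 0%N) * (a 0%N - a 1%N) =
        (b 0%N * a 0%N + (b 1%N * a 1%N + (b 2%N * a 0%N + (b 3%N * a 1%N + 0)))) -
        a 1%N * (b 0%N * 1 + (b 1%N * 1 + (b 2%N * 1 + (b 3%N * 1 + 0)))) by ring.
      by rewrite h1 h0 mulr0 subr0.
    by rewrite mulf_eq0 subr_eq0 (negPf n01) orbF.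
  have b3 : b 3%N = - b 1%N.
    by apply/eqP; rewrite -addr_eq0 -[X in _ == X]h0 b2; apply/eqP; ring.
  rewrite b2 b3 => h; have : b 0%N * b 1%N * (a 1%N - a 0%N) ^+ 3 != 0.
    by rewrite mulf_neq0 ?mulf_neq0 ?b0 ?expf_neq0 ?subr_eq0 // eq_sym.
  apply/negP; rewrite negbK -[X in _ == X]h; apply/eqP; ring.
have := an 0%N isT; have := an 1%N isT; have := an 2%N isT; have := an 3%N isT.
move=> n34 n23 n12 n01.
have {}cnt c : (size c <= 3)%N ->
  count (fun y => y \notin c) [:: a 0%N; a 1%N; a 2%N; a 3%N; a 4%N] <> 1%N by exact: cnt.
(* For [l = 5] the conditions are invariant under rotation, so [pentagon_chord] applies to all five
   chords and the [a i] are pairwise distinct. *)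
have rcnt k c : (size c <= 3)%N ->
    count (fun y => y \notin c) (rot k [:: a 0%N; a 1%N; a 2%N; a 3%N; a 4%N]) <> 1%N.
  by move=> c3; rewrite (seq.permP (permEl (perm_rot k _))); exact: cnt.
have n02 : a 0%N != a 2%N by apply: (pentagon_chord cnt).
have n13 : a 1%N != a 3%N by apply: (pentagon_chord (rcnt 1%N)).
have n24 : a 2%N != a 4%N by apply: (pentagon_chord (rcnt 2%N)).
have n30 : a 3%N != a 0%N by apply: (pentagon_chord (rcnt 3%N)).
have n41 : a 4%N != a 1%N by apply: (pentagon_chord (rcnt 4%N)).
have := m0 0%N isT; have := m0 1%N isT; have := m0 2%N isT; have := m0 3%N isT.
have b4 := b0 4%N isT; move: b4 {rcnt cnt m0 an b0}.
rewrite /area /moment /index_iota /= !big_cons !big_nil.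
move: (a 0%N) (a 1%N) (a 2%N) (a 3%N) (a 4%N) (b 0%N) (b 1%N) (b 2%N) (b 3%N) (b 4%N)
  al n34 n23 n12 n01 n02 n13 n24 n30 n41 => a0 a1 a2 a3 a4 b0 b1 b2 b3 b4.
have nz (x y : F) : x != y -> x - y != 0 by rewrite subr_eq0.
move=> /nz d40 /nz d34 /nz d23 /nz d12 /nz d01 /nz d02 /nz d13 /nz d24 /nz d30 /nz d41.
move=> b4n h3 h2 h1 h0 hT.
pose M j := b0 * a0 ^+ j +
  (b1 * a1 ^+ j + (b2 * a2 ^+ j + (b3 * a3 ^+ j + (b4 * a4 ^+ j + 0)))).
(* The [b i] are, up to a common factor, the inverses of the products of the
   [a i - a j] with [j != i]; the area is then, up to sign, the square of that
   factor divided by the product of the [a i - a (i + 2)]. *)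
have lin p q r : b0 * ((a0 - p) * (a0 - q) * (a0 - r)) +
    b1 * ((a1 - p) * (a1 - q) * (a1 - r)) + b2 * ((a2 - p) * (a2 - q) * (a2 - r)) +
    b3 * ((a3 - p) * (a3 - q) * (a3 - r)) + b4 * ((a4 - p) * (a4 - q) * (a4 - r)) = 0.
  transitivity (M 3%N - (p + q + r) * M 2%N + (p * q + q * r + r * p) * M 1%N -
    p * q * r * M 0%N); first by rewrite /M; ring.
  rewrite (h0 : M 0%N = 0) (h1 : M 1%N = 0) (h2 : M 2%N = 0) (h3 : M 3%N = 0).
  by rewrite !mulr0 !subr0 addr0.
have solve (x y z t : F) : y != 0 -> x * y + z * t = 0 -> x = - (z * t) / y.
  move=> y0 /eqP; rewrite addr_eq0 => /eqP h; apply: (mulIf y0).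
  by rewrite h mulfVK.
have e0 : b0 = - (b4 * ((a4 - a1) * (a4 - a2) * (a4 - a3))) /
    ((a0 - a1) * (a0 - a2) * (a0 - a3)).
  apply: solve; last by rewrite -[RHS](lin a1 a2 a3); ring.
  by rewrite !mulf_neq0 // -opprB oppr_eq0.
have e1 : b1 = - (b4 * ((a4 - a0) * (a4 - a2) * (a4 - a3))) /
    ((a1 - a0) * (a1 - a2) * (a1 - a3)).
  apply: solve; last by rewrite -[RHS](lin a0 a2 a3); ring.
  by rewrite !mulf_neq0 // -opprB oppr_eq0.
have e2 : b2 = - (b4 * ((a4 - a0) * (a4 - a1) * (a4 - a3))) /
    ((a2 - a0) * (a2 - a1) * (a2 - a3)).
  apply: solve; last by rewrite -[RHS](lin a0 a1 a3); ring.
  by rewrite !mulf_neq0 // -opprB oppr_eq0.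
have e3 : b3 = - (b4 * ((a4 - a0) * (a4 - a1) * (a4 - a2))) /
    ((a3 - a0) * (a3 - a1) * (a3 - a2)).
  apply: solve; last by rewrite -[RHS](lin a0 a1 a2); ring.
  by rewrite !mulf_neq0 // -opprB oppr_eq0.
have : b4 ^+ 2 * ((a4 - a0) * (a4 - a1) * (a4 - a2) * (a4 - a3)) ^+ 2 /
    ((a0 - a2) * (a1 - a3) * (a2 - a4) * (a3 - a0) * (a4 - a1)) != 0.
  have d43 : a4 - a3 != 0 by rewrite -opprB oppr_eq0.
  have d42 : a4 - a2 != 0 by rewrite -opprB oppr_eq0.
  by rewrite !(mulf_neq0, invr_eq0, expf_neq0).
apply/negP; rewrite negbK -oppr_eq0 -[X in _ == X]hT e0 e1 e2 e3.
apply/eqP; field.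
by do ?[apply/andP; split]; rewrite // -opprB oppr_eq0.
Qed.

End HexagonRelations.

Section Hexagon.
Local Open Scope ring_scope.
Variable F : finFieldType.

Definition hex_edge := (F * F * F * F * F * F)%type.

Definition hex_point (e : hex_edge) : F * F * F * F * F := e.1.

(* Incidence: p2 + l2 = p1 l1, p3 + l3 = p1 l2, p4 + l4 = p1 l3 and
   p5 + l5 = p2 l3 - p3 l2, so that an edge is determined by its point and l1. *)
Definition hex_line (e : hex_edge) : F * F * F * F * F :=
  let: (p1, p2, p3, p4, p5, l1) := e in
  let l2 := p1 * l1 - p2 in let l3 := p1 * l2 - p3 in let l4 := p1 * l3 - p4 in
  (l1, l2, l3, l4, p2 * l3 - p3 * l2 - p5).

Definition hex_abscissa (e : hex_edge) : F := e.1.1.1.1.1.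

Definition hex_slope (e : hex_edge) : F := e.2.

(** The new line meets the old one in a point of abscissa [a]; the other coordinates of that point
    are eliminated by the incidence equations. *)
Definition hex_shift (a b : F) (l : F * F * F * F * F) :=
  let: (l1, l2, l3, l4, l5) := l in
  (l1 + b, l2 + b * a, l3 + b * a ^+ 2, l4 + b * a ^+ 3,
   l5 + b * a * (a ^+ 2 * l1 - a * l2 *+ 2 + l3)).

Lemma hex_step (e e1 e2 : hex_edge) :
  hex_point e = hex_point e1 -> e <> e1 -> hex_line e1 = hex_line e2 -> e1 <> e2 ->
  [/\ hex_slope e2 - hex_slope e != 0, hex_abscissa e != hex_abscissa e2 &
      hex_line e2 = hex_shift (hex_abscissa e) (hex_slope e2 - hex_slope e) (hex_line e)].
Proof.
case: e e1 e2 => [[[[[p1 p2] p3] p4] p5] l1] [q l1'] [[[[[r1 r2] r3] r4] r5] m1].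
rewrite /hex_point /= => <- {q} ne /= + ne1 => -[e1 e2 e3 e4 e5].
rewrite /hex_slope /hex_abscissa /=; split.
- by rewrite subr_eq0 -e1; apply/eqP => h; apply: ne; rewrite h.
- apply/eqP => h; apply: ne1; rewrite -e1 -h in e2 e3 e4 e5 *.
  move/addrI/oppr_inj: e2 e3 e4 e5 => ->.
  by move/addrI/oppr_inj => -> /addrI/oppr_inj -> /addrI/oppr_inj ->.
rewrite -e5 -e4 -e3 -e2 -e1; congr (_, _, _, _, _); ring.
Qed.

Lemma hexagon_girth : girth_geq hex_point hex_line 12.
Proof.
move=> l e l0 l6 he e_closed.
pose a i := hex_abscissa (e i.*2).
pose b i := hex_slope (e i.+1.*2) - hex_slope (e i.*2).
have step i : (i < l)%N -> [/\ b i != 0, a i != a i.+1 &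
    hex_line (e i.+1.*2) = hex_shift (a i) (b i) (hex_line (e i.*2))].
  by move=> /he[h1 h2 h3 h4]; exact: hex_step h1 h2 h3 h4.
case E0 : (hex_line (e 0)) => [[[[x1 x2] x3] x4] x5].
(* The terms in [x1], [x2], [x3] come from the initial line. Closing the walk kills the four
   moments, hence these terms, and then the area. *)
have line i : (i <= l)%N -> hex_line (e i.*2) =
    (x1 + moment a b 0 i, x2 + moment a b 1 i, x3 + moment a b 2 i,
     x4 + moment a b 3 i,
     x5 + area a b i + x1 * moment a b 3 i - x2 * moment a b 2 i *+ 2 +
       x3 * moment a b 1 i).
  elim: i => [_|i IH il].
    by rewrite E0 /area /moment !big_geq // !mulr0 mul0rn subr0 !addr0.
  have [_ _ ->] := step i il; rewrite (IH (ltnW il)) /hex_shift.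
  have mS j : moment a b j i.+1 = moment a b j i + b i * a i ^+ j.
    by rewrite /moment big_nat_recr.
  rewrite [area a b i.+1]/area big_nat_recr //= -/(area a b i) !mS.
  by congr (_, _, _, _, _); ring.
have := line l (leqnn l); rewrite e_closed E0 => -[h0 h1 h2 h3 h5].
have cancel (x y : F) : x = x + y -> y = 0.
  by move=> h; apply: (addrI x); rewrite addr0.
move/cancel: h0 => h0; move/cancel: h1 => h1; move/cancel: h2 => h2; move/cancel: h3 => h3.
move: h5; rewrite h1 h2 h3 !mulr0 mul0rn subr0 !addr0 => /cancel.
apply: hexagon_relation.
- by rewrite l0; lia.
- by move=> i /step[].
- by move=> i /ltnW /step[].
- have /step[_ + _] : (l.-1 < l)%N by rewrite prednK.
  by rewrite prednK // {2}/a e_closed.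
- by do 4!case=> //.
Qed.

Lemma card_hex_edge : #|{: hex_edge}| = (#|F| ^ 6)%N.
Proof. by rewrite !card_prod !expnSr expn0 mul1n. Qed.

Lemma card_hex_point : #|{: F * F * F * F * F}| = (#|F| ^ 5)%N.
Proof. by rewrite !card_prod !expnSr expn0 mul1n. Qed.

End Hexagon.

(** * Asymptotics *)

Lemma sA_dense (E V1 V2 : finType) (u : E -> V1) (v : E -> V2) (g n m q : nat) :
  girth_geq u v g -> 4 < g -> 4 * n <= 3 * g -> 0 < #|E| ->
  #|V1| * q = #|E| -> #|V2| * q = #|E| ->
  sA m n 2 <= 3 * #|E| + 2 * (m %/ q).
Proof.
move=> hg g4 ng E0 hV1 hV2.
have q0 : 0 < q by move: E0; rewrite -hV1 muln_gt0 => /andP[].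
(* Rounding the block size up by [q] instead of 1 costs only [#|E|] cells on each side; with the
   orientation bits this makes [3 * #|E|]. *)
have mE : m <= #|E| * (q + m %/ #|E|).
  rewrite {1}(divn_eq m #|E|) mulnDr addnC [#|E| * (m %/ _)]mulnC leq_add2r.
  by rewrite (leq_trans (ltnW (ltn_pmod m E0))) // leq_pmulr.
apply: (leq_trans (sA_graph hg g4 ng mE)).
have fold_div V : V * q = #|E| -> V * (q + m %/ #|E|) <= #|E| + m %/ q.
  by move=> <-; rewrite mulnDr leq_add2l mulnC [V * q]mulnC divnMA leq_trunc_div.
rewrite mulnDl; have := fold_div _ hV1; have := fold_div _ hV2.
move: (_ * (q + _)) (_ * (q + _)) => x y; lia.
Qed.

(** The girth is at least [2 * N.+1], so [4 * n <= 3 * g] becomes [2 * n <= 3 * N.+1]. The degree is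
    the order [2 ^ e] of a root group. *)
Lemma sA_unipotent n N e m : 0 < e -> 1 < N -> 2 * n <= 3 * N.+1 ->
  sA m n 2 <= 3 * (2 ^ e) ^ (N + N./2) + 2 * (m %/ 2 ^ e).
Proof.
move=> e0 N1 nN; have [F _ cF] := PrimePowerField (isT : prime 2) e0.
have hg := unipotent_girth (F := F) N1.
have cE := card_coset_edge (unipotent F N).
rewrite -cF; apply: (@leq_trans (3 * #|unipotent F N| + 2 * (m %/ #|F|))); last first.
  by rewrite leq_add2r leq_mul2l card_unipotent.
rewrite -cE; apply: (sA_dense m hg) => //.
- by move: N1; clear; lia.
- by move: nN; clear; lia.
- by rewrite cE cardG_gt0.
- by rewrite cE -(card_root_group F N1 false) card_coset_vertex // root_sub.
- by rewrite cE -(card_root_group F N1 true) card_coset_vertex // root_sub.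
Qed.

Lemma sA_hexagon n e m : 0 < e -> n <= 9 ->
  sA m n 2 <= 3 * (2 ^ e) ^ 6 + 2 * (m %/ 2 ^ e).
Proof.
move=> e0 n9; have [F _ cF] := PrimePowerField (isT : prime 2) e0.
have q0 : 0 < #|F| by rewrite cF expn_gt0.
rewrite -cF -card_hex_edge; apply: (sA_dense m (@hexagon_girth F)) => //.
- by move: n9; clear; lia.
- by rewrite card_hex_edge expn_gt0 q0.
- by rewrite card_hex_edge card_hex_point -expnSr.
- by rewrite card_hex_edge card_hex_point -expnSr.
Qed.

From mathcomp Require Import all_classical all_reals all_analysis.

Import Order.TTheory Num.Theory.
Import numFieldNormedType.Exports.
Local Open Scope classical_set_scope.
Local Open Scope ring_scope.

(** With [x] the root of [m] of order [k.+1], some [q = 2 ^ e] satisfies [q <= x < 2 * q], and both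
    terms of the bound are then of order [x ^+ k]. *)
Lemma bigO_of_power2 (R : realType) (f : nat -> nat) (k : nat) :
  (forall e m, (0 < e)%N -> (f m <= 3 * (2 ^ e) ^ k + 2 * (m %/ 2 ^ e))%N) ->
  (fun m : nat => (f m)%:R : R) =O_\oo
  (fun m : nat => m%:R `^ (1 - 1 / k.+1%:R) : R).
Proof.
(* The constant is [3 + 2 * 2], from [q ^ k <= x ^+ k] and [m %/ q <= 2 * x ^+ k]. *)
move=> hf; apply/eqO_exP; exists 7 => //.
exists (2 ^ k.+1)%N => // m /= mk.
have K1 : (1 < 2 ^ k.+1)%N by rewrite -{1}(expn0 2) ltn_exp2l.
have m0 : (0 < m)%N by apply: leq_trans mk; rewrite expn_gt0.
have /andP[] := trunc_log_bounds K1 m0.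
set e := trunc_log _ m => em me.
have e0 : (0 < e)%N by apply: trunc_log_max => //; rewrite expn1.
set q := (2 ^ e)%N.
have qm : (q ^ k.+1 <= m)%N by rewrite /q -expnM mulnC expnM.
have mq : (m < (2 * q) ^ k.+1)%N.
  by move: me; rewrite /q -expnS -!expnM mulnC.
pose x : R := m%:R `^ (1 / k.+1%:R).
have x0 : 0 <= x by exact: powR_ge0.
have kr : k.+1%:R != 0 :> R by rewrite pnatr_eq0.
have xK : x ^+ k.+1 = m%:R.
  by rewrite -powR_mulrn // -powRrM mul1r mulVf // powRr1.
have yE : m%:R `^ (1 - 1 / k.+1%:R) = x ^+ k.
  have -> : 1 - 1 / k.+1%:R = 1 / k.+1%:R * k%:R :> R.
    by apply: (mulIf kr); rewrite mulrBl !mul1r mulVf // mulrAC mulVf // mul1r -natr1 addrK.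
  by rewrite powRrM powR_mulrn.
have qx : q%:R <= x by rewrite -(@ler_pXn2r _ k.+1) ?nnegrE ?ler0n // xK -natrX ler_nat.
have xq : x < 2 * q%:R.
  rewrite -(@ltr_pXn2r _ k.+1) ?nnegrE ?mulr_ge0 ?ler0n // xK.
  by rewrite -natrM -natrX ltr_nat.
have q0 : 0 < q%:R :> R by rewrite ltr0n /q expn_gt0.
rewrite yE !ger0_norm ?exprn_ge0 ?ler0n //.
have /(leq_trans (hf e m e0)) /= : (3 * q ^ k + 2 * (m %/ q) <= 3 * q ^ k + 2 * (m %/ q))%N by [].
rewrite -(ler_nat R) natrD !natrM natrX => /le_trans; apply.
have h1 : q%:R ^+ k <= x ^+ k by rewrite lerXn2r // nnegrE ler0n.
have h2 : (m %/ q)%:R <= 2 * x ^+ k :> R.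
  rewrite -(ler_pM2r q0) -natrM (le_trans (y := m%:R)) ?ler_nat ?leq_trunc_div //.
  rewrite -xK exprS mulrAC ler_wpM2r ?exprn_ge0 //; exact: ltW.
rewrite (le_trans (lerD (ler_wpM2l _ h1) (ler_wpM2l _ h2))) //.
by rewrite mulrA -mulrDl -!natrM -natrD.
Qed.

Unset Implicit Arguments.

Theorem theorem1 (R : realType) (n : nat) (hn : (4 <= n)%N) :
  [/\ (n = 0 %[mod 3])%N ->
        (fun m : nat => (sA m n 2)%:R : R)
          =O_\oo (fun m : nat => m%:R `^ (1 - 1 / (n%:R - 1)) : R),
      (n = 1 %[mod 3])%N \/ (n = 2 %[mod 3])%N ->
        (fun m : nat => (sA m n 2)%:R : R)
          =O_\oo (fun m : nat => m%:R `^ (1 - 1 / n%:R) : R)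
    & n = 8%N \/ n = 9%N ->
        (fun m : nat => (sA m n 2)%:R : R)
          =O_\oo (fun m : nat => m%:R `^ (6 / 7) : R)].
Proof.
split.
(* For [n = 3 r] the choice [N = 2 r - 1] gives [2 * n = 3 * N.+1] and [N + N./2 = n - 2]. *)
- move=> n3; have -> : n%:R - 1 = (n - 2).+1%:R :> R.
    have -> : (n - 2).+1 = (n - 1)%N by move: hn; clear; lia.
    by rewrite natrB // (leq_trans _ hn).
  apply: bigO_of_power2 => e m e0.
  have := @sA_unipotent n (2 * (n %/ 3)).-1 e m e0.
  have -> : ((2 * (n %/ 3)).-1 + (2 * (n %/ 3)).-1./2 = n - 2)%N.
    by move: n3 hn; clear; lia.
  by apply; move: n3 hn; clear; lia.
- move=> n3; have -> : n = n.-1.+1 by rewrite prednK // (leq_trans _ hn).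
  apply: bigO_of_power2 => e m e0; rewrite prednK ?(leq_trans _ hn) //.
  (* For [n = 3 r + 1] and [n = 3 r + 2] the choices [N = 2 r] and [N = 2 r + 1] both give
     [N + N./2 = n - 1]. *)
  case: n3 => n3.
    have := @sA_unipotent n (2 * (n %/ 3)) e m e0.
    have -> : ((2 * (n %/ 3)) + (2 * (n %/ 3))./2 = n.-1)%N.
      by move: n3 hn; clear; lia.
    by apply; move: n3 hn; clear; lia.
  have := @sA_unipotent n (2 * (n %/ 3)).+1 e m e0.
  have -> : ((2 * (n %/ 3)).+1 + (2 * (n %/ 3)).+1./2 = n.-1)%N.
    by move: n3 hn; clear; lia.
  by apply; move: n3 hn; clear; lia.
- move=> n89; have -> : 6 / 7 = 1 - 1 / 7 :> R by lra.
  apply: bigO_of_power2 => e m e0; apply: sA_hexagon => //.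
  by case: n89 => ->.
Qed.
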